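(* For Frölicher spaces $X$ and $Y$, the Frölicher spaces $T(X\times Y)$ and $TX\times TY$ are isomorphic.
   Context: A Frölicher structure on a set $X$ is a pair $(C,F)$ with $C \subset \mathrm{Map}(\mathbb R,X)$ and $F\subset \mathrm{Map}(X,\mathbb R)$ such that $C=\{c:\mathbb R\to X \mid f\circ c\in C^\infty(\mathbb R,\mathbb R)\ \forall f\in F\}$ and $F=\{f:X\to\mathbb R\mid f\circ c\in C^\infty(\mathbb R,\mathbb R)\ \forall c\in C\}$. Elements of $C$ and $F$ are called (smooth) curves and (smooth) functions. A map $\phi:X\to Y$ of Frölicher spaces is smooth if $\phi\circ c$ is a curve of $Y$ for every curve $c$ of $X$; an isomorphism is a smooth bijection with smooth inverse. Given maps $f_i:X\to X_i$ into Frölicher spaces, the initial structure on $X$ is the one whose curves are those $c$ with every $f_i\circ c$ a curve of $X_i$. Products carry the initial structure with respect to the projections. Tangent bundle: for $x\in X$ let $C_x=\{c\in C: c(0)=x\}$; $c\sim d$ in $C_x$ iff $(f\circ c)'(0)=(f\circ d)'(0)$ for all $f\in F$; $T_xX=C_x/\!\sim$, with classes $[c]$. $TX$ is the disjoint union of the $T_xX$; for smooth $\phi$, $T\phi([c])=[\phi\circ c]$. $T\mathbb R$ is identified with $\mathbb R^2$ via $[c]\mapsto(c(0),c'(0))$, and $TX$ carries the initial Frölicher structure with respect to all $Tf:TX\to T\mathbb R=\mathbb R^2$, $f\in F$. *)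

(* Defs.v *)
(* Stdlib reals with Coquelicot. *)
From Stdlib Require Import Reals Lra Lia.
From Stdlib Require Import FunctionalExtensionality PropExtensionality.
From Stdlib Require Import ProofIrrelevance ClassicalEpsilon.
From Coquelicot Require Import Coquelicot.
Open Scope R_scope.

Definition smooth (f : R -> R) : Prop := forall n x, ex_derive_n f n x.

Fixpoint smooth_upto (n : nat) (f : R -> R) : Prop :=
  match n with
  | O => True
  | S m => (forall x, ex_derive f x) /\ smooth_upto m (Derive f)
  end.

Lemma Derive_n_Derive (f : R -> R) (n : nat) :
  Derive_n (Derive f) n = Derive_n f (S n).
Proof.
induction n as [|n IHn]; [reflexivity|].
change (Derive (Derive_n (Derive f) n) = Derive (Derive_n f (S n))).
now rewrite IHn.
Qed.

Lemma smooth_step (f : R -> R) :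
  smooth f <-> (forall x, ex_derive f x) /\ smooth (Derive f).
Proof.
split.
- intros H; split.
  + intros x; exact (H 1%nat x).
  + intros [|n] x; [exact I|].
    change (ex_derive (Derive_n (Derive f) n) x).
    rewrite Derive_n_Derive; exact (H (S (S n)) x).
- intros [H0 H1] [|[|n]] x; [exact I|exact (H0 x)|].
  change (ex_derive (Derive_n f (S n)) x).
  rewrite <- Derive_n_Derive; exact (H1 (S n) x).
Qed.

Lemma smooth_uptoP (f : R -> R) : smooth f <-> forall n, smooth_upto n f.
Proof.
split.
- intros H n; revert f H; induction n as [|n IHn]; intros f H; [exact I|].
  apply smooth_step in H; destruct H as [H0 H1]; split; auto.
- intros H n; revert f H; induction n as [|n IHn]; intros f H x; [exact I|].
  destruct n as [|n]; [exact (proj1 (H 1%nat) x)|].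
  change (ex_derive (Derive_n f (S n)) x).
  rewrite <- Derive_n_Derive.
  apply (IHn (Derive f)); intros m; exact (proj2 (H (S m))).
Qed.

Lemma smooth_upto_pred n f : smooth_upto (S n) f -> smooth_upto n f.
Proof.
revert f; induction n as [|n IHn]; intros f; [easy|].
intros [H0 H1]; split; auto.
Qed.

Lemma smooth_upto_plus n f g : smooth_upto n f -> smooth_upto n g ->
  smooth_upto n (fun x => f x + g x).
Proof.
revert f g; induction n as [|n IHn]; intros f g; [easy|].
intros [f0 f1] [g0 g1]; split.
- intros x; apply (ex_derive_plus f g); auto.
- replace (Derive (fun x => f x + g x))
    with (fun x => Derive f x + Derive g x); [now apply IHn|].
  apply functional_extensionality; intros x.
  symmetry; apply Derive_plus; auto.
Qed.

Lemma smooth_upto_mult n f g : smooth_upto n f -> smooth_upto n g ->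
  smooth_upto n (fun x => f x * g x).
Proof.
revert f g; induction n as [|n IHn]; intros f g; [easy|].
intros Hf Hg; pose proof (smooth_upto_pred _ _ Hf);
  pose proof (smooth_upto_pred _ _ Hg).
destruct Hf as [f0 f1], Hg as [g0 g1]; split.
- intros x; apply ex_derive_mult; auto.
- replace (Derive (fun x => f x * g x))
    with (fun x => Derive f x * g x + f x * Derive g x).
  + now apply smooth_upto_plus; apply IHn.
  + apply functional_extensionality; intros x.
    symmetry; apply Derive_mult; auto.
Qed.

Lemma smooth_upto_comp n f g : smooth_upto n f -> smooth_upto n g ->
  smooth_upto n (fun x => f (g x)).
Proof.
revert f g; induction n as [|n IHn]; intros f g; [easy|].
intros Hf Hg; pose proof (smooth_upto_pred _ _ Hg).
destruct Hf as [f0 f1], Hg as [g0 g1]; split.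
- intros x; apply (ex_derive_comp f g); auto.
- replace (Derive (fun x => f (g x)))
    with (fun x => Derive g x * Derive f (g x)).
  + now apply smooth_upto_mult; [|apply IHn].
  + apply functional_extensionality; intros x.
    symmetry; apply (Derive_comp f g); auto.
Qed.

Lemma smooth_comp f g : smooth f -> smooth g -> smooth (fun x => f (g x)).
Proof.
rewrite !smooth_uptoP; intros Hf Hg n; now apply smooth_upto_comp.
Qed.

Lemma smooth_ex_derive f : smooth f -> forall x, ex_derive f x.
Proof. intros H x; exact (H 1%nat x). Qed.

Lemma smooth_const (a : R) : smooth (fun _ => a).
Proof. intros n x; apply ex_derive_n_const. Qed.

Lemma smooth_id : smooth (fun x => x).
Proof.
apply smooth_step; split; [intros x; apply ex_derive_id|].
replace (Derive (fun x => x)) with (fun _ : R => 1); [apply smooth_const|].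
apply functional_extensionality; intros x; symmetry; apply Derive_id.
Qed.

Record frolicher := Frolicher {
  carrier :> Type;
  curve : (R -> carrier) -> Prop;
  funct : (carrier -> R) -> Prop;
  curveP : forall c, curve c <->
    (forall f, funct f -> smooth (fun t => f (c t)));
  functP : forall f, funct f <->
    (forall c, curve c -> smooth (fun t => f (c t)))
}.

Definition smooth_map (X Y : frolicher) (phi : X -> Y) : Prop :=
  forall c, curve X c -> curve Y (fun t => phi (c t)).

Definition is_isomorphism (X Y : frolicher) (phi : X -> Y) : Prop :=
  smooth_map X Y phi /\
  exists psi : Y -> X, smooth_map Y X psi /\
    (forall x, psi (phi x) = x) /\ (forall y, phi (psi y) = y).

Definition isomorphic (X Y : frolicher) : Prop :=
  exists phi : X -> Y, is_isomorphism X Y phi.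

Section Initial.
Variables (X : Type) (I : Type) (Z : I -> frolicher) (h : forall i, X -> Z i).

Definition initial_curve (c : R -> X) : Prop :=
  forall i, curve (Z i) (fun t => h i (c t)).

Definition initial_funct (f : X -> R) : Prop :=
  forall c, initial_curve c -> smooth (fun t => f (c t)).

Lemma initial_curveP c : initial_curve c <->
  (forall f, initial_funct f -> smooth (fun t => f (c t))).
Proof.
split; [intros Hc f Hf; exact (Hf c Hc)|].
intros H i; apply curveP; intros g Hg.
apply (H (fun x => g (h i x))).
intros d Hd; exact (proj1 (curveP (Z i) _) (Hd i) g Hg).
Qed.

Definition initial : frolicher :=
  Frolicher X initial_curve initial_funct initial_curveP
    (fun f => iff_refl _).
End Initial.

Lemma real_curveP (c : R -> R) :
  smooth c <-> (forall f, smooth f -> smooth (fun t => f (c t))).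
Proof.
split; [intros Hc f Hf; now apply smooth_comp|].
intros H; exact (H (fun x => x) smooth_id).
Qed.

Lemma real_functP (f : R -> R) :
  smooth f <-> (forall c, smooth c -> smooth (fun t => f (c t))).
Proof.
split; [intros Hf c Hc; now apply smooth_comp|].
intros H; exact (H (fun x => x) smooth_id).
Qed.

Definition realF : frolicher := Frolicher R smooth smooth real_curveP real_functP.

Definition prodF (X Y : frolicher) : frolicher :=
  initial (X * Y) bool (fun b => if b then X else Y)
    (fun b => match b return X * Y -> (if b then X else Y) with
              | true => fst
              | false => snd
              end).

Lemma prod_curve (X Y : frolicher) (c : R -> prodF X Y) :
  curve (prodF X Y) c <->
  curve X (fun t => fst (c t)) /\ curve Y (fun t => snd (c t)).
Proof.
split; [intros H; split; [exact (H true)|exact (H false)]|].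
intros [H1 H2] [|]; assumption.
Qed.

Definition curve_at (X : frolicher) (x : X) (c : R -> X) : Prop :=
  curve X c /\ c 0 = x.

(* Only used on curves, where [f o c] is smooth, so that the total operator
   [Derive] is the derivative. *)
Definition tangent_eq (X : frolicher) (c d : R -> X) : Prop :=
  forall f, funct X f ->
    Derive (fun t => f (c t)) 0 = Derive (fun t => f (d t)) 0.

Definition tangent_class (X : frolicher) (x : X) (c : R -> X) :
    (R -> X) -> Prop :=
  fun d => curve_at X x d /\ tangent_eq X c d.

(* The quotient of [curve_at X x] by [tangent_eq X], as the type of its
   equivalence classes. *)
Definition tangent_space (X : frolicher) (x : X) : Type :=
  { S : (R -> X) -> Prop |
    exists c, curve_at X x c /\ S = tangent_class X x c }.

Definition tangent_total (X : frolicher) : Type :=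
  { x : X & tangent_space X x }.

Definition tangent (X : frolicher) (c : R -> X) (Hc : curve X c) :
    tangent_total X :=
  existT _ (c 0)
    (exist _ (tangent_class X (c 0) c)
       (ex_intro _ c (conj (conj Hc eq_refl) eq_refl))).

Lemma tangent_classP (X : frolicher) (x : X) (c d : R -> X) :
  curve_at X x c -> curve_at X x d ->
  tangent_class X x c = tangent_class X x d <-> tangent_eq X c d.
Proof.
intros Hc Hd; split.
- intros E.
  assert (H : tangent_class X x d d) by (split; [exact Hd|intros f _; reflexivity]).
  rewrite <- E in H; exact (proj2 H).
- intros E; apply functional_extensionality; intros e.
  apply propositional_extensionality; split; intros [He H]; split; trivial;
    intros f Hf.
  + rewrite <- (E f Hf); auto.
  + rewrite (E f Hf); auto.
Qed.

Lemma tangentP (X : frolicher) (c d : R -> X) (Hc : curve X c) (Hd : curve X d) :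
  tangent X c Hc = tangent X d Hd <-> c 0 = d 0 /\ tangent_eq X c d.
Proof.
split.
- intros E.
  assert (E0 : c 0 = d 0) by exact (f_equal (@projT1 _ _) E).
  split; [exact E0|].
  assert (H : forall v w : tangent_total X, v = w ->
      proj1_sig (projT2 v) = proj1_sig (projT2 w))
    by (intros v w ->; reflexivity).
  specialize (H _ _ E); simpl in H; rewrite <- E0 in H.
  apply (tangent_classP X (c 0)) in H; [exact H|now split|now split].
- intros [E0 E].
  assert (G : forall x (c1 d1 : R -> X) (H1 : curve_at X x c1)
      (H2 : curve_at X x d1), tangent_eq X c1 d1 ->
      existT (tangent_space X) x
        (exist _ (tangent_class X x c1) (ex_intro _ c1 (conj H1 eq_refl))) =
      existT (tangent_space X) x
        (exist _ (tangent_class X x d1) (ex_intro _ d1 (conj H2 eq_refl)))).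
  { intros x c1 d1 H1 H2 E1; apply f_equal.
    apply subset_eq_compat; now apply tangent_classP. }
  assert (D : forall y (e : d 0 = y),
      tangent X d Hd = existT (tangent_space X) y
        (exist _ (tangent_class X y d) (ex_intro _ d (conj (conj Hd e) eq_refl)))).
  { intros y e; destruct e; reflexivity. }
  rewrite (D (c 0) (eq_sym E0)); now apply G.
Qed.

Definition tangent_rep (X : frolicher) (v : tangent_total X) : R -> X :=
  proj1_sig (constructive_indefinite_description _ (proj2_sig (projT2 v))).

Lemma tangent_rep_spec (X : frolicher) (v : tangent_total X) :
  curve_at X (projT1 v) (tangent_rep X v) /\
  proj1_sig (projT2 v) = tangent_class X (projT1 v) (tangent_rep X v).
Proof.
exact (proj2_sig
  (constructive_indefinite_description _ (proj2_sig (projT2 v)))).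
Qed.

Lemma tangent_rep_curve (X : frolicher) (v : tangent_total X) :
  curve X (tangent_rep X v).
Proof. exact (proj1 (proj1 (tangent_rep_spec X v))). Qed.

Lemma tangent_repK (X : frolicher) (v : tangent_total X) :
  tangent X (tangent_rep X v) (tangent_rep_curve X v) = v.
Proof.
generalize (tangent_rep_curve X v).
destruct (tangent_rep_spec X v) as [[_ E0] E].
revert E0 E; generalize (tangent_rep X v).
destruct v as [x [S HS]]; simpl; intros c E0 E Hc.
unfold tangent; subst x S; apply f_equal; now apply subset_eq_compat.
Qed.

Lemma tangent_rep_eq (X : frolicher) (c : R -> X) (Hc : curve X c) :
  tangent_rep X (tangent X c Hc) 0 = c 0 /\
  tangent_eq X (tangent_rep X (tangent X c Hc)) c.
Proof. apply (tangentP X _ c (tangent_rep_curve X _) Hc), tangent_repK. Qed.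

(* Independent of the chosen representative: see [tangent_mapE]. *)
Definition tangent_map (X Y : frolicher) (phi : X -> Y)
    (Hphi : smooth_map X Y phi) (v : tangent_total X) : tangent_total Y :=
  tangent Y (fun t => phi (tangent_rep X v t))
    (Hphi _ (tangent_rep_curve X v)).

Lemma smooth_map_funct (X Y : frolicher) (phi : X -> Y) (g : Y -> R) :
  smooth_map X Y phi -> funct Y g -> funct X (fun x => g (phi x)).
Proof.
intros Hphi Hg; apply functP; intros c Hc.
exact (proj1 (functP Y g) Hg _ (Hphi c Hc)).
Qed.

Lemma tangent_mapE (X Y : frolicher) (phi : X -> Y)
    (Hphi : smooth_map X Y phi) (c : R -> X) (Hc : curve X c) :
  tangent_map X Y phi Hphi (tangent X c Hc) =
  tangent Y (fun t => phi (c t)) (Hphi c Hc).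
Proof.
destruct (tangent_rep_eq X c Hc) as [E0 E].
unfold tangent_map; apply tangentP; split; [now rewrite E0|].
intros g Hg; exact (E _ (smooth_map_funct X Y phi g Hphi Hg)).
Qed.

(* The identification of [T R] with [R * R]: see [tangent_realE] and
   [tangent_real_bij]. *)
Definition tangent_real (v : tangent_total realF) : R * R :=
  (tangent_rep realF v 0, Derive (tangent_rep realF v) 0).

Lemma tangent_realE (c : R -> R) (Hc : curve realF c) :
  tangent_real (tangent realF c Hc) = (c 0, Derive c 0).
Proof.
destruct (tangent_rep_eq realF c Hc) as [E0 E].
unfold tangent_real; rewrite E0; f_equal.
exact (E (fun x => x) smooth_id).
Qed.

Lemma tangent_real_bij :
  (forall v w, tangent_real v = tangent_real w -> v = w) /\
  (forall p, exists v, tangent_real v = p).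
Proof.
split.
- intros v w E; injection E as E0 E1.
  rewrite <- (tangent_repK realF v), <- (tangent_repK realF w).
  apply tangentP; split; [exact E0|].
  assert (Sv : smooth (tangent_rep realF v)) by exact (tangent_rep_curve realF v).
  assert (Sw : smooth (tangent_rep realF w)) by exact (tangent_rep_curve realF w).
  intros f Hf.
  rewrite (Derive_comp f (tangent_rep realF v)); try now apply smooth_ex_derive.
  rewrite (Derive_comp f (tangent_rep realF w)); try now apply smooth_ex_derive.
  now rewrite E0, E1.
- intros [a b].
  assert (H : smooth (fun t => a + b * t)).
  { apply smooth_uptoP; intros n; apply smooth_upto_plus;
      [|apply smooth_upto_mult]; apply smooth_uptoP;
      first [apply smooth_const|apply smooth_id]. }
  exists (tangent realF _ H); rewrite tangent_realE; f_equal; [ring|].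
  apply is_derive_unique; auto_derive; [trivial|ring].
Qed.

Lemma funct_smooth_map (X : frolicher) (f : X -> R) :
  funct X f -> smooth_map X realF f.
Proof. intros Hf c Hc; exact (proj1 (functP X f) Hf c Hc). Qed.

Definition TF (X : frolicher) : frolicher :=
  initial (tangent_total X) { f : X -> R | funct X f }
    (fun _ => prodF realF realF)
    (fun f v => tangent_real
       (tangent_map X realF (proj1_sig f)
          (funct_smooth_map X (proj1_sig f) (proj2_sig f)) v)).

(* Main.v *)
Require Import Defs.
From Stdlib Require Import Reals Lra Lia.
From Stdlib Require Import FunctionalExtensionality ClassicalEpsilon Classical.
From Coquelicot Require Import Coquelicot.
Open Scope R_scope.

(** The isomorphism is [z |-> (T fst z, T snd z)], with inverse
    [([c], [d]) |-> [(c, d)]]. The inverse is well defined because a function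
    of [X * Y], restricted along a pair of curves, is a function of the plane
    that is smooth along smooth curves, so it has continuous partial
    derivatives (Boman) and the chain rule splits its derivative into a part
    depending on [[c]] and one depending on [[d]]. For the smoothness of the
    inverse one has to see that [t |-> v_t (f_t)] is smooth when [v_t] is a
    curve in [T X] and [f_t] a smooth family of functions. This holds because
    [h (t, s) = v_t (f_s)] is smooth in each variable and its pure partial
    derivatives are locally bounded, by the uniform boundedness principle for
    functionals on the smooth functions of [X]; such a function of two
    variables is smooth, by the argument that also proves Boman's theorem. *)

(** * Smooth functions and limits *)

(** The obstacle is that a curve of [T X] is tested only against fixed functions, while a function
    [f] of [X * Y] at base points [(x_t, y_t)] gives the moving functions [f (-, y_t)] on [X].
    Smoothness in [t] and in the parameter separately does not give smoothness on the diagonal, so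
    some uniformity must be found, although neither [X] nor its set of functions comes with a
    topology. It is obtained by measuring functions through their derivatives along each curve.
    Completeness is then automatic: a series over a bounded sequence with geometrically decreasing
    coefficients converges with all derivatives along every curve, and its sum is a function of [X]
    because everything that is smooth along curves is one. Uniform boundedness says nothing about
    mixed derivatives. These are reached by approximating one partial derivative by difference
    quotients of very high order, so that Landau's inequality can trade smallness for derivatives in
    the other variable. The resulting class is closed under both partial derivatives, and all orders
    follow by induction. *)

Definition cpt_bounded {I : Type} (phi : I -> R -> R) : Prop :=
  forall A, exists C, forall i t, Rabs t <= A -> Rabs (phi i t) <= C.

Lemma choice {A B : Type} (P : A -> B -> Prop) :
  (forall x, exists y, P x y) -> exists f, forall x, P x (f x).
Proof.
intros H; exists (fun x => proj1_sig (constructive_indefinite_description _ (H x))).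
intros x; exact (proj2_sig (constructive_indefinite_description _ (H x))).
Qed.

Lemma smooth_Derive f : smooth f -> smooth (Derive f).
Proof. intros H; exact (proj2 (proj1 (smooth_step f) H)). Qed.

Lemma smooth_Derive_n f n : smooth f -> smooth (Derive_n f n).
Proof.
revert f; induction n as [|n IHn]; intros f Hf; [exact Hf|].
rewrite <- Derive_n_Derive; now apply IHn, smooth_Derive.
Qed.

Lemma smooth_lin f g a b : smooth f -> smooth g ->
  smooth (fun x => a * f x + b * g x).
Proof.
intros Hf Hg; apply smooth_uptoP; intros n.
apply smooth_upto_plus; apply smooth_upto_mult; apply smooth_uptoP;
  trivial; apply smooth_const.
Qed.

Lemma smooth_mult f g : smooth f -> smooth g -> smooth (fun x => f x * g x).
Proof.
rewrite !smooth_uptoP; intros Hf Hg n; now apply smooth_upto_mult.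
Qed.

Lemma smooth_plus f g : smooth f -> smooth g -> smooth (fun x => f x + g x).
Proof.
rewrite !smooth_uptoP; intros Hf Hg n; now apply smooth_upto_plus.
Qed.

Lemma smooth_affine a b : smooth (fun x => a * x + b).
Proof.
apply smooth_plus; [apply smooth_mult|]; auto using smooth_const, smooth_id.
Qed.

Lemma Derive_lin f g a b : smooth f -> smooth g ->
  Derive (fun x => a * f x + b * g x) =
  (fun x => a * Derive f x + b * Derive g x).
Proof.
intros Hf Hg; apply functional_extensionality; intros x.
apply smooth_ex_derive with (x := x) in Hf, Hg.
rewrite Derive_plus; [|now apply ex_derive_scal..].
now rewrite !Derive_scal.
Qed.

Lemma Derive_n_lin f g a b n : smooth f -> smooth g ->
  Derive_n (fun x => a * f x + b * g x) n =
  (fun x => a * Derive_n f n x + b * Derive_n g n x).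
Proof.
revert f g; induction n as [|n IHn]; intros f g Hf Hg; [reflexivity|].
rewrite <- !Derive_n_Derive, Derive_lin; auto using smooth_Derive.
Qed.

Lemma Derive_n_affine f (a b : R) n : smooth f ->
  Derive_n (fun x => f (a * x + b)) n =
  (fun x => a ^ n * Derive_n f n (a * x + b)).
Proof.
intros Hf; revert f Hf; induction n as [|n IHn]; intros f Hf.
- apply functional_extensionality; intros x; simpl; ring.
- rewrite <- !Derive_n_Derive.
  (* The summand [0 * 0] only gives the function the shape of [Derive_n_lin]. *)
  replace (Derive (fun x => f (a * x + b)))
    with (fun x => a * Derive f (a * x + b) + 0 * 0).
  + rewrite Derive_n_lin.
    * rewrite (IHn (Derive f)) by now apply smooth_Derive.
      apply functional_extensionality; intros x; simpl; ring.
    * apply (smooth_comp (Derive f)); [now apply smooth_Derive|apply smooth_affine].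
    * apply smooth_const.
  + apply functional_extensionality; intros x.
    rewrite (Derive_comp f (fun x => a * x + b));
      [|now apply smooth_ex_derive|exact (smooth_ex_derive _ (smooth_affine a b) x)].
    rewrite Rmult_0_l, Rplus_0_r; f_equal.
    symmetry; apply is_derive_unique; auto_derive; [trivial|ring].
Qed.

Lemma smooth_continuity f x : smooth f -> continuity_pt f x.
Proof.
intros Hf; apply continuity_pt_filterlim, (ex_derive_continuous f).
now apply smooth_ex_derive.
Qed.

Lemma smooth_bounded f A : smooth f ->
  exists C, forall t, Rabs t <= A -> Rabs (f t) <= C.
Proof.
intros Hf; destruct (Rle_dec 0 A) as [HA|HA].
- destruct (continuity_ab_maj (fun x => Rabs (f x)) (-A) A) as [M [HM _]]; [lra| |].
  + intros c _; apply (continuity_pt_comp f Rabs);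
      [now apply smooth_continuity|apply Rcontinuity_abs].
  + exists (Rabs (f M)); intros t Ht; apply HM; apply Rabs_le_between; lra.
- exists 0; intros t Ht; pose proof (Rabs_pos t); lra.
Qed.

Lemma mean_value f x y : smooth f ->
  exists c, Rmin x y <= c <= Rmax x y /\ f y - f x = Derive f c * (y - x).
Proof.
intros Hf; apply MVT_gen.
- intros z _; apply Derive_correct; now apply smooth_ex_derive.
- intros z _; now apply smooth_continuity.
Qed.

Lemma lipschitz_bound f x y C : smooth f ->
  (forall c, Rmin x y <= c <= Rmax x y -> Rabs (Derive f c) <= C) ->
  Rabs (f y - f x) <= C * Rabs (y - x).
Proof.
intros Hf H; destruct (mean_value f x y Hf) as [c [Hc ->]].
rewrite Rabs_mult; apply Rmult_le_compat_r; [apply Rabs_pos|auto].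
Qed.

Lemma Rabs_sub_between x y c : Rmin x y <= c <= Rmax x y ->
  Rabs (c - x) <= Rabs (y - x).
Proof.
unfold Rmin, Rmax; intros H; destruct (Rle_dec x y);
  unfold Rabs; repeat destruct Rcase_abs; lra.
Qed.

(** The mean value theorem is applied twice, to [f] and to its derivative, at the cost of the factor
    1/2 of Taylor's formula. *)
Lemma taylor2 f x h C : smooth f ->
  (forall c, Rabs (c - x) <= Rabs h -> Rabs (Derive_n f 2 c) <= C) ->
  Rabs (f (x + h) - f x - h * Derive f x) <= C * (h * h).
Proof.
intros Hf H; destruct (mean_value f x (x + h) Hf) as [c [Hc E]].
assert (Hcx := Rabs_sub_between _ _ _ Hc).
replace (x + h - x) with h in Hcx by ring.
replace (f (x + h) - f x - h * Derive f x)
  with ((Derive f c - Derive f x) * h) by (rewrite E; ring).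
assert (C0 : 0 <= C).
{ apply Rle_trans with (2 := H x ltac:(rewrite Rminus_diag, Rabs_R0; apply Rabs_pos)).
  apply Rabs_pos. }
replace (h * h) with (Rabs h * Rabs h)
  by (rewrite <- Rabs_mult; apply Rabs_pos_eq, Rle_0_sqr).
rewrite Rabs_mult, <- Rmult_assoc; apply Rmult_le_compat_r; [apply Rabs_pos|].
apply Rle_trans with (C * Rabs (c - x)).
- apply lipschitz_bound; [now apply smooth_Derive|].
  intros d Hd; apply (H d); apply Rle_trans with (2 := Hcx).
  now apply Rabs_sub_between.
- now apply Rmult_le_compat_l.
Qed.

(** For functions whose differentiability is still open: pointwise limits, and [flat] at 0. *)
Lemma is_derive_quadratic w t l C :
  (forall h, Rabs h <= 1 -> Rabs (w (t + h) - w t - h * l) <= C * (h * h)) ->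
  is_derive w t l.
Proof.
intros H; apply is_derive_Reals; intros eps Heps.
assert (C0 : 0 < Rabs C + 1) by (pose proof (Rabs_pos C); lra).
assert (D0 : 0 < Rmin 1 (eps / (Rabs C + 1))).
{ apply Rmin_pos; [lra|]; now apply Rdiv_lt_0_compat. }
exists (mkposreal _ D0); intros h h0 Hh; simpl in Hh.
assert (Hh1 : Rabs h < 1) by (eapply Rlt_le_trans; [exact Hh|apply Rmin_l]).
assert (Hh2 : Rabs h < eps / (Rabs C + 1))
  by (eapply Rlt_le_trans; [exact Hh|apply Rmin_r]).
assert (Hp : 0 < Rabs h) by now apply Rabs_pos_lt.
replace ((w (t + h) - w t) / h - l) with ((w (t + h) - w t - h * l) / h)
  by now field.
unfold Rdiv; rewrite Rabs_mult, Rabs_inv.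
apply Rmult_lt_reg_r with (Rabs h); [exact Hp|].
rewrite Rmult_assoc, Rinv_l, Rmult_1_r by lra.
apply Rle_lt_trans with (1 := H h (Rlt_le _ _ Hh1)).
apply Rle_lt_trans with ((Rabs C + 1) * Rabs h * Rabs h).
- replace (h * h) with (Rabs h * Rabs h)
    by (rewrite <- Rabs_mult; apply Rabs_pos_eq, Rle_0_sqr).
  rewrite Rmult_assoc; apply Rmult_le_compat_r; [now apply Rmult_le_pos; apply Rabs_pos|].
  pose proof (Rle_abs C); lra.
- apply Rmult_lt_compat_r; [exact Hp|].
  apply Rmult_lt_reg_r with (/ (Rabs C + 1)); [now apply Rinv_0_lt_compat|].
  replace ((Rabs C + 1) * Rabs h * / (Rabs C + 1)) with (Rabs h) by (field; lra).
  exact Hh2.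
Qed.

Lemma lim_seq_Rabs_le (u : nat -> R) (l C : R) : is_lim_seq u (Finite l) ->
  (forall n, Rabs (u n) <= C) -> Rabs l <= C.
Proof.
intros Hu H; apply is_lim_seq_abs in Hu.
exact (is_lim_seq_le _ (fun _ => C) _ (Finite C) H Hu (is_lim_seq_const C)).
Qed.

Lemma cpt_bounded_pos {I : Type} (phi : I -> R -> R) A : cpt_bounded phi ->
  exists C, 0 < C /\ forall i t, Rabs t <= A -> Rabs (phi i t) <= C.
Proof.
intros H; destruct (H A) as [C HC]; exists (Rabs C + 1); split.
- pose proof (Rabs_pos C); lra.
- intros i t Ht; pose proof (HC i t Ht); pose proof (Rle_abs C); lra.
Qed.

(* A bound on the second derivatives alone makes the derivatives converge:
   they are within [C h] of the difference quotients of step [h]. *)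
Lemma limit_derive (phi : nat -> R -> R) (w : R -> R) :
  (forall n, smooth (phi n)) ->
  cpt_bounded (fun n => Derive_n (phi n) 2) ->
  (forall t, is_lim_seq (fun n => phi n t) (w t)) ->
  forall t, ex_derive w t /\
    is_lim_seq (fun n => Derive (phi n) t) (Derive w t).
Proof.
intros Hs Hb Hw t.
destruct (cpt_bounded_pos _ (Rabs t + 1) Hb) as [C [C0 HC]].
assert (T : forall n h, Rabs h <= 1 ->
  Rabs (phi n (t + h) - phi n t - h * Derive (phi n) t) <= C * (h * h)).
{ intros n h Hh; apply taylor2; [auto|].
  intros c Hc; apply HC.
  replace c with (t + (c - t)) by ring.
  eapply Rle_trans; [apply Rabs_triang|lra]. }
assert (L : ex_finite_lim_seq (fun n => Derive (phi n) t)).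
{ apply ex_lim_seq_cauchy_corr; intros eps.
  assert (E0 := cond_pos eps).
  (* After division by [h], each of the two Taylor remainders contributes at most [eps / 4], and so
     does each of the differences of values at [t] and at [t + h]. *)
  set (h := Rmin 1 (eps / (4 * C))).
  assert (h0 : 0 < h) by (apply Rmin_pos; [lra|]; apply Rdiv_lt_0_compat; lra).
  assert (h1 : h <= 1) by apply Rmin_l.
  assert (h2 : 4 * C * h <= eps).
  { replace (pos eps) with (4 * C * (eps / (4 * C))) by (field; lra).
    apply Rmult_le_compat_l; [lra|apply Rmin_r]. }
  assert (K : forall x, exists N : nat, forall n m, (N <= n)%nat -> (N <= m)%nat ->
      Rabs (phi n x - phi m x) < h * (eps / 4)).
  { intros x.
    assert (F : ex_finite_lim_seq (fun n => phi n x)) by (exists (w x); apply Hw).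
    apply ex_lim_seq_cauchy_corr in F.
    assert (P : 0 < h * (eps / 4)) by (apply Rmult_lt_0_compat; lra).
    exact (F (mkposreal _ P)). }
  destruct (K t) as [N1 H1], (K (t + h)) as [N2 H2].
  exists (max N1 N2); intros n m Hn Hm.
  specialize (H1 n m ltac:(lia) ltac:(lia)).
  specialize (H2 n m ltac:(lia) ltac:(lia)).
  assert (Hh : Rabs h <= 1) by (rewrite Rabs_pos_eq; lra).
  pose proof (T n h Hh) as T1; pose proof (T m h Hh) as T2.
  apply Rmult_lt_reg_l with h; [exact h0|].
  assert (Q : C * (h * h) <= h * (eps / 4)).
  { replace (C * (h * h)) with (h * (4 * C * h / 4)) by field.
    apply Rmult_le_compat_l; lra. }
  rewrite <- (Rabs_pos_eq h) at 1 by lra; rewrite <- Rabs_mult.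
  apply Rabs_le_between in T1, T2; apply Rabs_lt_between in H1, H2.
  apply Rabs_lt_between; split; lra. }
destruct L as [l Hl].
assert (D : is_derive w t l).
{ apply is_derive_quadratic with C; intros h Hh.
  apply lim_seq_Rabs_le with (2 := fun n => T n h Hh).
  apply (is_lim_seq_minus' (fun n => phi n (t + h) - phi n t) (fun n => h * Derive (phi n) t)).
  - apply is_lim_seq_minus'; apply Hw.
  - apply (is_lim_seq_scal_l _ h (Finite l)), Hl. }
split; [now exists l|]; now rewrite (is_derive_unique w t l D).
Qed.

(** One more derivative is bounded than is obtained in the limit, because [limit_derive] spends a
    bound on second derivatives to get a first one. *)
Lemma limit_smooth_upto m (phi : nat -> R -> R) (w : R -> R) :
  (forall n, smooth (phi n)) ->
  (forall p, (p <= S m)%nat -> cpt_bounded (fun n => Derive_n (phi n) p)) ->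
  (forall t, is_lim_seq (fun n => phi n t) (w t)) ->
  smooth_upto m w /\
  forall p t, (p <= m)%nat ->
    is_lim_seq (fun n => Derive_n (phi n) p t) (Derive_n w p t).
Proof.
revert phi w; induction m as [|m IHm]; intros phi w Hs Hb Hw.
- split; [exact I|]; intros p t Hp; replace p with 0%nat by lia; apply Hw.
- pose proof (limit_derive phi w Hs (Hb 2%nat ltac:(lia)) Hw) as H.
  destruct (IHm (fun n => Derive (phi n)) (Derive w)) as [K1 K2].
  + intros n; now apply smooth_Derive.
  + intros p Hp A; destruct (Hb (S p) ltac:(lia) A) as [C HC].
    exists C; intros n t Ht; rewrite Derive_n_Derive; auto.
  + intros t; apply H.
  + split; [split; [intros t; apply H|exact K1]|].
    intros [|p] t Hp; [apply Hw|].
    rewrite <- Derive_n_Derive.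
    apply is_lim_seq_ext with (fun n => Derive_n (Derive (phi n)) p t).
    * intros n; now rewrite Derive_n_Derive.
    * apply K2; lia.
Qed.

Lemma limit_smooth (phi : nat -> R -> R) (w : R -> R) :
  (forall n, smooth (phi n)) ->
  (forall p, cpt_bounded (fun n => Derive_n (phi n) p)) ->
  (forall t, is_lim_seq (fun n => phi n t) (w t)) ->
  smooth w /\
  forall p t, is_lim_seq (fun n => Derive_n (phi n) p t) (Derive_n w p t).
Proof.
intros Hs Hb Hw; split.
- apply smooth_uptoP; intros m; now apply (limit_smooth_upto m phi).
- intros p t; now apply (limit_smooth_upto p phi).
Qed.

(** * Functions smooth along curves have bounded derivatives *)

(** [flat 0] is the classical flat function; the powers of [/ x] make the family stable under
    derivation, so that one induction proves all members smooth. *)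
Definition flat (k : nat) (x : R) : R :=
  if Rlt_dec 0 x then (/ x) ^ k * exp (- / x) else 0.

Lemma flat_pos k x : 0 < x -> flat k x = (/ x) ^ k * exp (- / x).
Proof. intros H; unfold flat; destruct (Rlt_dec 0 x); [reflexivity|lra]. Qed.

Lemma flat_neg k x : x <= 0 -> flat k x = 0.
Proof. intros H; unfold flat; destruct (Rlt_dec 0 x); [lra|reflexivity]. Qed.

(** Write [y] as [m] times [z] and raise [z <= exp z] to the power [m]; this gives the constant
    [m ^ m]. *)
Lemma pow_le_exp m : exists C, forall y, 0 <= y -> y ^ m <= C * exp y.
Proof.
destruct m as [|m].
{ exists 1; intros y Hy; simpl; pose proof (exp_ineq1_le y); lra. }
assert (HM : 0 < INR (S m)) by (apply lt_0_INR; lia).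
exists (INR (S m) ^ S m); intros y Hy.
assert (E : forall z n, exp (INR n * z) = exp z ^ n).
{ intros z n; induction n as [|n IHn]; [rewrite Rmult_0_l; apply exp_0|].
  rewrite S_INR, <- tech_pow_Rmult, <- IHn, <- exp_plus; f_equal; ring. }
set (z := y / INR (S m)).
assert (Hz : 0 <= z) by (apply Rdiv_le_0_compat; lra).
replace y with (INR (S m) * z) by (unfold z; field; lra).
rewrite E, Rpow_mult_distr.
apply Rmult_le_compat_l; [apply pow_le; lra|].
apply pow_incr; split; [exact Hz|]; pose proof (exp_ineq1_le z); lra.
Qed.

Lemma flat_quadratic k : exists C, forall x, Rabs (flat k x) <= C * (x * x).
Proof.
destruct (pow_le_exp (k + 2)) as [C HC]; exists C; intros x.
destruct (Rlt_dec 0 x) as [Hx|Hx].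
- assert (Hi : 0 < / x) by now apply Rinv_0_lt_compat.
  rewrite flat_pos by exact Hx.
  rewrite Rabs_pos_eq by (apply Rmult_le_pos; [apply pow_le; lra|left; apply exp_pos]).
  specialize (HC (/ x) (Rlt_le _ _ Hi)).
  rewrite exp_Ropp; set (e := exp (/ x)) in *.
  assert (He : 0 < e) by apply exp_pos.
  apply Rmult_le_reg_r with (/ x * / x * e); [repeat apply Rmult_lt_0_compat; lra|].
  replace ((/ x) ^ k * / e * (/ x * / x * e)) with ((/ x) ^ (k + 2))
    by (rewrite pow_add; field; lra).
  replace (C * (x * x) * (/ x * / x * e)) with (C * e) by (field; lra).
  exact HC.
- rewrite flat_neg, Rabs_R0 by lra.
  assert (H1 := HC 1 Rle_0_1); rewrite pow1 in H1.
  assert (0 < C).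
  { apply Rmult_lt_reg_r with (exp 1); [apply exp_pos|lra]. }
  apply Rmult_le_pos; [lra|apply Rle_0_sqr].
Qed.

Lemma is_derive_flat k x :
  is_derive (flat k) x (- INR k * flat (k + 1) x + 1 * flat (k + 2) x).
Proof.
destruct (total_order_T x 0) as [[Hx|Hx]|Hx].
- apply is_derive_ext_loc with (fun _ => 0).
  + assert (D : 0 < - x) by lra.
    exists (mkposreal _ D); intros y Hy.
    change (Rabs (y - x) < - x) in Hy; apply Rabs_def2 in Hy.
    rewrite flat_neg; lra.
  + rewrite !flat_neg by lra.
    replace (- INR k * 0 + 1 * 0) with 0 by ring; apply (is_derive_const (K := R_AbsRing) 0).
- subst x; rewrite !flat_neg by lra.
  destruct (flat_quadratic k) as [C HC].
  apply is_derive_quadratic with C; intros h _.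
  rewrite (flat_neg k 0), Rplus_0_l by lra.
  replace (flat k h - 0 - h * (- INR k * 0 + 1 * 0)) with (flat k h) by ring.
  apply HC.
- apply is_derive_ext_loc with (fun x => (/ x) ^ k * exp (- / x)).
  + exists (mkposreal _ Hx); intros y Hy.
    change (Rabs (y - x) < x) in Hy; apply Rabs_def2 in Hy.
    rewrite flat_pos; lra.
  + rewrite !flat_pos by lra.
    auto_derive; [lra|].
    rewrite !pow_add; destruct k as [|k].
    * simpl; field; lra.
    * rewrite Nat.pred_succ; rewrite <- (tech_pow_Rmult _ k); field; lra.
Qed.

Lemma flat_smooth k : smooth (flat k).
Proof.
apply smooth_uptoP; intros n; revert k; induction n as [|n IHn]; intros k; [exact I|].
split; [intros x; eexists; apply is_derive_flat|].
replace (Derive (flat k))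
  with (fun x => - INR k * flat (k + 1) x + 1 * flat (k + 2) x).
- apply smooth_upto_plus; apply smooth_upto_mult; auto;
    apply smooth_uptoP, smooth_const.
- apply functional_extensionality; intros x.
  symmetry; apply is_derive_unique, is_derive_flat.
Qed.

(** The radius 1/4 makes the rescaled copies around the points [/ 2 ^ n] disjoint; on the plateau of
    radius 1/8 a curve can be prescribed exactly. *)
Lemma smooth_plateau : exists chi, smooth chi /\
  (forall z, Rabs (z - 1) <= / 8 -> chi z = 1) /\
  (forall z, / 4 <= Rabs (z - 1) -> chi z = 0).
Proof.
(* This is [flat 0 (/ 64)]. The argument [(z - 1)^2 - / 64] is nonpositive within distance 1/8 of 1
   and at least 3/64 beyond distance 1/4. *)
set (c := exp (- 64)).
assert (Hc : 0 < c) by apply exp_pos.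
assert (Fc : flat 0 c <> 0).
{ rewrite flat_pos by exact Hc; simpl; rewrite Rmult_1_l; apply Rgt_not_eq, exp_pos. }
(* [flat 0 (c - flat 0 x)] is constant for [x <= 0] and vanishes as soon as
   [flat 0 x >= c]: a smooth step without any division of functions. *)
exists (fun z => / flat 0 c * flat 0 (c - flat 0 ((z - 1) * (z - 1) - / 64))).
split; [|split].
- apply (smooth_mult (fun _ => / flat 0 c)); [apply smooth_const|].
  apply (smooth_comp (flat 0)); [apply flat_smooth|].
  apply (smooth_comp (fun y => c - y)).
  + replace (fun y => c - y) with (fun y => -1 * y + c); [apply smooth_affine|].
    apply functional_extensionality; intros y; ring.
  + apply (smooth_comp (flat 0)); [apply flat_smooth|].
    replace (fun t => (t - 1) * (t - 1) - / 64)
      with (fun t => t * t + (- 2 * t + (1 - / 64)))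
      by (apply functional_extensionality; intros t; ring).
    apply smooth_plus; [|apply smooth_affine].
    apply smooth_mult; apply smooth_id.
- intros z Hz.
  assert (Hz2 : (z - 1) * (z - 1) <= / 64).
  { apply Rabs_le_between in Hz; nra. }
  rewrite (flat_neg 0 ((z - 1) * (z - 1) - / 64)), Rminus_0_r by lra.
  now field.
- intros z Hz; set (x := (z - 1) * (z - 1) - / 64).
  assert (Hx : / 64 <= x).
  { unfold x; pose proof (Rsqr_abs (z - 1)) as E; unfold Rsqr in E.
    rewrite E; set (r := Rabs (z - 1)) in *; assert (/ 4 * / 4 <= r * r) by (apply Rmult_le_compat; lra); lra. }
  assert (Hf : c <= flat 0 x).
  { rewrite flat_pos by lra; simpl; rewrite Rmult_1_l.
    assert (Hi : / x <= 64).
    { rewrite <- (Rinv_inv 64); apply Rinv_le_contravar; lra. }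
    destruct (Rle_lt_or_eq_dec _ _ Hi) as [L| ->]; [|apply Rle_refl].
    left; apply exp_increasing; lra. }
  rewrite (flat_neg 0 (c - flat 0 x)) by lra; ring.
Qed.

Lemma Derive_n_vanish f p A : smooth f ->
  (forall t, A <= Rabs t -> f t = 0) ->
  exists C, forall t, Rabs (Derive_n f p t) <= C.
Proof.
intros Hf H0.
destruct (smooth_bounded (Derive_n f p) A (smooth_Derive_n f p Hf)) as [C HC].
exists (Rmax C 0); intros t; destruct (Rle_dec (Rabs t) A) as [Ht|Ht].
- apply Rle_trans with (2 := Rmax_l _ _); auto.
- replace (Derive_n f p t) with 0; [rewrite Rabs_R0; apply Rmax_r|].
  rewrite (Derive_n_ext_loc f (fun _ => 0) p t).
  + destruct p as [|p]; [reflexivity|symmetry; apply Derive_n_const].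
  + assert (D : 0 < Rabs t - A) by lra.
    exists (mkposreal _ D); intros y Hy; change (Rabs (y - t) < Rabs t - A) in Hy.
    apply H0; pose proof (Rabs_triang_inv t y); rewrite (Rabs_minus_sym t y) in *; lra.
Qed.

(** Partial sums of bumps of width and position [/ 2 ^ m], with disjoint supports in the
    applications. The neutral [1 *] and [+ 0] match [Derive_n_lin] and [Derive_n_affine]. *)
Fixpoint lacunary (psi : R -> R) (lambda : nat -> R) (n : nat) : R -> R :=
  match n with
  | O => fun _ => 0
  | S m => fun t => 1 * lacunary psi lambda m t + lambda m * psi (2 ^ m * t + 0)
  end.

Lemma lacunary_smooth psi lambda n : smooth psi -> smooth (lacunary psi lambda n).
Proof.
intros Hp; induction n as [|n IHn]; [exact (smooth_const 0)|].
apply smooth_lin; [exact IHn|].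
apply (smooth_comp psi); [exact Hp|apply smooth_affine].
Qed.

(** In exponents this is [n (p + 1) <= (p + 1)^2 + n^2]. The weights [(/ 2) ^ (n * n)] beat the
    factor [(2 ^ n) ^ p] that [p] derivatives produce on the bump of index [n], with a summable
    factor left over. *)
Lemma pow2_sq_bound n p : (2 ^ n) ^ p * (/ 2) ^ (n * n) <= 2 ^ ((p + 1) * (p + 1)) * (/ 2) ^ n.
Proof.
apply Rmult_le_reg_r with (2 ^ (n * n) * 2 ^ n).
{ apply Rmult_lt_0_compat; apply pow_lt; lra. }
rewrite !pow_inv.
assert (H1 : 0 < 2 ^ (n * n)) by (apply pow_lt; lra).
assert (H2 : 0 < 2 ^ n) by (apply pow_lt; lra).
replace ((2 ^ n) ^ p * / 2 ^ (n * n) * (2 ^ (n * n) * 2 ^ n))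
  with (2 ^ (n * (p + 1)))
  by (rewrite <- pow_mult, Nat.mul_add_distr_l, Nat.mul_1_r, pow_add; field; lra).
replace (2 ^ ((p + 1) * (p + 1)) * / 2 ^ n * (2 ^ (n * n) * 2 ^ n))
  with (2 ^ ((p + 1) * (p + 1) + n * n)) by (rewrite pow_add; field; lra).
apply Rle_pow; [lra|]; nia.
Qed.

Lemma lacunary_bounded psi lambda p A : smooth psi ->
  (forall t, A <= Rabs t -> psi t = 0) ->
  (forall n, Rabs (lambda n) <= (/ 2) ^ (n * n)) ->
  cpt_bounded (fun n => Derive_n (lacunary psi lambda n) p).
Proof.
intros Hp H0 Hl B.
destruct (Derive_n_vanish psi p A Hp H0) as [M HM].
set (K := 2 ^ ((p + 1) * (p + 1))).
assert (M0 : 0 <= M) by (eapply Rle_trans; [apply Rabs_pos|apply (HM 0)]).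
assert (K0 : 0 < K) by (apply pow_lt; lra).
exists (2 * (K * M)); intros n t _.
(* The partial sum of the geometric series is kept in the bound so that the induction closes. *)
apply Rle_trans with (K * M * (2 - 2 * (/ 2) ^ n)).
- induction n as [|n IHn].
  + simpl pow; simpl lacunary.
    replace (Derive_n (fun _ => 0) p t) with 0; [rewrite Rabs_R0; lra|].
    destruct p as [|p]; [reflexivity|symmetry; apply Derive_n_const].
  + simpl lacunary; rewrite Derive_n_lin; [|now apply lacunary_smooth|].
    2: apply (smooth_comp psi); [exact Hp|apply smooth_affine].
    rewrite Derive_n_affine by exact Hp.
    apply Rle_trans with (1 := Rabs_triang _ _).
    rewrite Rmult_1_l.
    replace (K * M * (2 - 2 * (/ 2) ^ S n))
      with (K * M * (2 - 2 * (/ 2) ^ n) + K * (/ 2) ^ n * M)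
      by (rewrite <- tech_pow_Rmult; field).
    apply Rplus_le_compat; [exact IHn|].
    rewrite Rabs_mult, Rabs_mult, <- Rmult_assoc.
    rewrite (Rabs_pos_eq ((2 ^ n) ^ p)) by (apply pow_le, pow_le; lra).
    apply Rmult_le_compat; [|apply Rabs_pos| |apply HM].
    * apply Rmult_le_pos; [apply Rabs_pos|apply pow_le, pow_le; lra].
    * apply Rle_trans with (2 := pow2_sq_bound n p).
      rewrite Rmult_comm; apply Rmult_le_compat_l; [|apply Hl].
      apply pow_le, pow_le; lra.
- rewrite (Rmult_comm 2 (K * M)); apply Rmult_le_compat_l; [nra|].
  assert (0 < (/ 2) ^ n) by (apply pow_lt; lra); lra.
Qed.

(** At each point the sum is eventually constant: all bumps vanish for [t <= 0], and for [t > 0] the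
    argument leaves the support once [2 ^ n * t >= 2]. *)
Lemma lacunary_cv psi lambda t :
  (forall z, / 4 <= Rabs (z - 1) -> psi z = 0) ->
  ex_finite_lim_seq (fun n => lacunary psi lambda n t).
Proof.
intros H0.
assert (H : exists N : nat, forall n, (N <= n)%nat -> psi (2 ^ n * t + 0) = 0).
{ destruct (Rle_dec t 0) as [Ht|Ht].
  - exists 0%nat; intros n _; apply H0.
    assert (0 < 2 ^ n) by (apply pow_lt; lra).
    assert (2 ^ n * t <= 0) by nra.
    rewrite Rabs_minus_sym, Rabs_pos_eq; lra.
  - destruct (Pow_x_infinity 2 ltac:(rewrite Rabs_pos_eq; lra) (2 / t)) as [N HN].
    exists N; intros n Hn; apply H0; specialize (HN n Hn).
    rewrite (Rabs_pos_eq (2 ^ n)) in HN by (apply pow_le; lra).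
    assert (2 <= 2 ^ n * t).
    { replace 2 with (2 / t * t) at 1 by (field; lra); apply Rmult_le_compat_r; lra. }
    rewrite Rabs_pos_eq; lra. }
destruct H as [N HN]; exists (lacunary psi lambda N t).
apply is_lim_seq_ext_loc with (fun _ => lacunary psi lambda N t);
  [|apply is_lim_seq_const].
exists N; intros n Hn; induction Hn as [|n Hn IHn]; [reflexivity|].
simpl; rewrite <- IHn, (HN n Hn); ring.
Qed.

Lemma lacunary_lim psi lambda t m :
  (forall z, / 4 <= Rabs (z - 1) -> psi z = 0) ->
  Rabs (2 ^ m * t - 1) <= / 8 ->
  is_lim_seq (fun n => lacunary psi lambda n t) (lambda m * psi (2 ^ m * t)).
Proof.
intros H0 Ht; apply Rabs_le_between in Ht.
assert (t0 : 0 < t).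
{ assert (0 < 2 ^ m) by (apply pow_lt; lra); nra. }
assert (L : forall n, (n <= m)%nat -> lacunary psi lambda n t = 0).
{ induction n as [|n IHn]; intros Hn; [reflexivity|].
  simpl; rewrite IHn by lia; rewrite H0; [ring|].
  assert (E : 2 ^ m = 2 ^ n * (2 * 2 ^ (m - n - 1))).
  { replace m with (n + S (m - n - 1))%nat at 1 by lia; now rewrite pow_add. }
  assert (1 <= 2 ^ (m - n - 1)) by (apply pow_R1_Rle; lra).
  assert (0 < 2 ^ n * t) by (apply Rmult_lt_0_compat; [apply pow_lt|]; lra).
  rewrite E in Ht.
  assert (2 ^ n * t * 2 <= 2 ^ n * (2 * 2 ^ (m - n - 1)) * t) by nra.
  rewrite Rabs_minus_sym, Rabs_pos_eq; lra. }
apply is_lim_seq_ext_loc with (fun _ => lambda m * psi (2 ^ m * t));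
  [|apply is_lim_seq_const].
exists (S m); intros n Hn; induction Hn as [|n Hn IHn].
- simpl; rewrite L by lia; rewrite Rplus_0_r; ring.
- simpl; rewrite <- IHn, (H0 (2 ^ n * t + 0)); [ring|].
  assert (E : 2 ^ n = 2 ^ m * (2 * 2 ^ (n - m - 1))).
  { replace n with (m + S (n - m - 1))%nat at 1 by lia; now rewrite pow_add. }
  assert (1 <= 2 ^ (n - m - 1)) by (apply pow_R1_Rle; lra).
  assert (2 ^ m * t * 2 <= 2 ^ n * t) by (rewrite E; nra).
  rewrite Rabs_pos_eq; lra.
Qed.

Lemma lacunary_curve psi lambda : smooth psi ->
  (forall z, / 4 <= Rabs (z - 1) -> psi z = 0) ->
  (forall n, Rabs (lambda n) <= (/ 2) ^ (n * n)) ->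
  exists a, smooth a /\ forall n t, Rabs (2 ^ n * t - 1) <= / 8 ->
    a t = lambda n * psi (2 ^ n * t).
Proof.
intros Hp H0 Hl.
destruct (choice _ (fun t => lacunary_cv psi lambda t H0)) as [w Hw].
exists w; split.
- apply (limit_smooth (lacunary psi lambda)); [|intros p|exact Hw].
  + intros n; now apply lacunary_smooth.
  + apply lacunary_bounded with 2; trivial.
    intros t Ht; apply H0; pose proof (Rabs_triang_inv t 1); rewrite Rabs_R1 in *; lra.
- intros n t Ht; assert (E := lacunary_lim psi lambda t n H0 Ht).
  apply is_lim_seq_unique in E; rewrite (is_lim_seq_unique _ _ (Hw t)) in E.
  now injection E.
Qed.

(** The special curve lemma of convenient calculus: affine pieces that shrink fast enough lie on one
    smooth curve, the piece of index [n] around time [/ 2 ^ n]. The bump [chi] carries the values,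
    and [chi z * (z - 1)] the slopes. *)
Lemma special_curve (alpha beta : nat -> R) :
  (forall n, Rabs (alpha n) <= (/ 2) ^ (n * n)) ->
  (forall n, Rabs (beta n) <= (/ 2) ^ (n * n)) ->
  exists a, smooth a /\ forall n t, Rabs (2 ^ n * t - 1) <= / 8 ->
    a t = alpha n + beta n * (2 ^ n * t - 1).
Proof.
intros Ha Hb; destruct smooth_plateau as [chi [Hs [H1 H0]]].
destruct (lacunary_curve chi alpha Hs H0 Ha) as [a [Sa Ea]].
destruct (lacunary_curve (fun z => chi z * (1 * z + - 1)) beta) as [b [Sb Eb]];
  [apply smooth_mult; [exact Hs|apply smooth_affine]
  |intros z Hz; rewrite H0 by exact Hz; ring|exact Hb|].
exists (fun t => a t + b t); split; [now apply smooth_plus|].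
intros n t Ht; rewrite (Ea n t Ht), (Eb n t Ht), H1 by exact Ht; ring.
Qed.

Definition loc_bounded (G : R -> R -> R) : Prop :=
  forall A, exists C, forall t u,
    Rabs t <= A -> Rabs u <= A -> Rabs (G t u) <= C.

Lemma loc_bounded_local (G : R -> R -> R) :
  (forall x y, exists d C, 0 < d /\ forall t u,
    Rabs (t - x) < d -> Rabs (u - y) < d -> Rabs (G t u) <= C) ->
  loc_bounded G.
Proof.
intros H A.
(* Radius and bound are merged into one positive number [d], with bound [/ d]; the lower bound on
   [delta] from [compactness_value_2d] is then a common bound for all points. *)
assert (H' : forall x y, exists d : posreal, forall t u,
  Rabs (t - x) < d -> Rabs (u - y) < d -> Rabs (G t u) <= / d).
{ intros x y; destruct (H x y) as [d [C [d0 HC]]].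
  assert (C1 : 0 < Rabs C + 1) by (pose proof (Rabs_pos C); lra).
  assert (D : 0 < Rmin d (/ (Rabs C + 1)))
    by (apply Rmin_pos; [exact d0|now apply Rinv_0_lt_compat]).
  exists (mkposreal _ D); simpl; intros t u Ht Hu.
  apply Rle_trans with (Rabs C + 1).
  - pose proof (Rle_abs C); apply Rle_trans with C; [|lra].
    apply HC; eapply Rlt_le_trans; eauto; apply Rmin_l.
  - rewrite <- (Rinv_inv (Rabs C + 1)) at 1; apply Rinv_le_contravar; [exact D|apply Rmin_r]. }
destruct (choice _ (fun x => choice _ (H' x))) as [delta Hd].
destruct (compactness_value_2d (-A) A (-A) A delta) as [d HD].
exists (/ d); intros t u Ht Hu; apply Rabs_le_between in Ht, Hu.
apply NNPP; intros N; apply (HD t u Ht Hu); intros [x [y [_ [_ [Hx [Hy L]]]]]].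
apply N, Rle_trans with (1 := Hd x y t u Hx Hy).
apply Rinv_le_contravar; [apply cond_pos|exact L].
Qed.

(** The hypothesis of Boman's theorem in the plane. It turns out equivalent to [bismooth], by
    [curve_smooth_bismooth] and [bismooth_curve_smooth]. *)
Definition curve_smooth (G : R -> R -> R) : Prop :=
  forall a b, smooth a -> smooth b -> smooth (fun t => G (a t) (b t)).

(** Otherwise there are points tending fast to some [(x, y)] where the derivative exceeds
    [n * (2 ^ (n * n)) ^ p]. A special curve passes through them at the times [/ 2 ^ n], parallel to
    the first axis and with speed [k = 2 ^ n / 2 ^ (n * n)]. Along it the derivative of order [p]
    exceeds [n * (2 ^ n) ^ p] at times in the unit interval, which contradicts smoothness. *)
Lemma curve_smooth_bounded G p : curve_smooth G ->
  loc_bounded (fun t u => Derive_n (fun x => G x u) p t).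
Proof.
intros HG; apply loc_bounded_local; intros x y.
apply NNPP; intros N.
assert (Q : forall n : nat, exists z : R * R,
  Rabs (fst z - x) <= (/ 2) ^ (n * n) /\ Rabs (snd z - y) <= (/ 2) ^ (n * n) /\
  INR n * (2 ^ (n * n)) ^ p < Rabs (Derive_n (fun x => G x (snd z)) p (fst z))).
{ intros n; apply NNPP; intros N2; apply N.
  exists ((/ 2) ^ (n * n)), (INR n * (2 ^ (n * n)) ^ p).
  split; [apply pow_lt; lra|]; intros t u Ht Hu.
  apply Rnot_lt_le; intros L; apply N2; exists (t, u); simpl; lra. }
destruct (choice _ Q) as [z Hz]; clear Q N.
assert (Hpow : forall n, Rabs ((/ 2) ^ (n * n)) <= (/ 2) ^ (n * n)).
{ intros n; rewrite Rabs_pos_eq; [lra|apply pow_le; lra]. }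
destruct (special_curve (fun n => fst (z n) - x) (fun n => (/ 2) ^ (n * n)))
  as [a [Sa Ea]]; [apply Hz|exact Hpow|].
destruct (special_curve (fun n => snd (z n) - y) (fun _ => 0)) as [b [Sb Eb]];
  [apply Hz|intros n; rewrite Rabs_R0; apply pow_le; lra|].
set (F t := G (a t + x) (b t + y)).
assert (SF : smooth F).
{ apply (HG (fun t => a t + x) (fun t => b t + y)); apply smooth_plus; trivial; apply smooth_const. }
destruct (smooth_bounded (Derive_n F p) 1 (smooth_Derive_n F p SF)) as [C HC].
destruct (INR_unbounded C) as [n Hn].
destruct (Hz n) as [_ [_ L]].
assert (P2 : 0 < 2 ^ n) by (apply pow_lt; lra).
set (k := (/ 2) ^ (n * n) * 2 ^ n).
set (g := fun x => G x (snd (z n))) in *.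
assert (E : Derive_n F p (/ 2 ^ n) =
  k ^ p * Derive_n g p (fst (z n))).
{ rewrite (Derive_n_ext_loc F
    (fun t => g (k * t + (fst (z n) - (/ 2) ^ (n * n))))).
  - rewrite (Derive_n_affine g).
    + do 2 f_equal; unfold k; field; lra.
    + apply (HG (fun x => x) (fun _ => snd (z n))); [apply smooth_id|apply smooth_const].
  - assert (D : 0 < / 2 ^ n * / 8) by (apply Rmult_lt_0_compat; [now apply Rinv_0_lt_compat|lra]).
    exists (mkposreal _ D); intros t Ht; change (Rabs (t - / 2 ^ n) < / 2 ^ n * / 8) in Ht.
    assert (Ht' : Rabs (2 ^ n * t - 1) <= / 8).
    { replace (2 ^ n * t - 1) with (2 ^ n * (t - / 2 ^ n)) by (field; lra).
      rewrite Rabs_mult, (Rabs_pos_eq (2 ^ n)) by lra.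
      apply Rmult_le_reg_l with (/ 2 ^ n); [now apply Rinv_0_lt_compat|].
      rewrite <- Rmult_assoc, Rinv_l, Rmult_1_l by lra; lra. }
    unfold F, g; rewrite (Ea n t Ht'), (Eb n t Ht'); f_equal; unfold k; ring. }
assert (H2 : Rabs (/ 2 ^ n) <= 1).
{ assert (1 <= 2 ^ n) by (apply pow_R1_Rle; lra).
  rewrite Rabs_pos_eq by (left; now apply Rinv_0_lt_compat).
  rewrite <- Rinv_1; apply Rinv_le_contravar; lra. }
specialize (HC _ H2); rewrite E, Rabs_mult in HC.
assert (k0 : 0 < k) by (apply Rmult_lt_0_compat; [apply pow_lt; lra|exact P2]).
rewrite (Rabs_pos_eq (k ^ p)) in HC by (apply pow_le; lra).
assert (Q : INR n <= k ^ p * (INR n * (2 ^ (n * n)) ^ p)).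
{ replace (k ^ p * (INR n * (2 ^ (n * n)) ^ p)) with (INR n * (2 ^ n) ^ p).
  - rewrite <- (Rmult_1_r (INR n)) at 1; apply Rmult_le_compat_l; [apply pos_INR|].
    rewrite <- pow_mult; apply pow_R1_Rle; lra.
  - replace (k ^ p * (INR n * (2 ^ (n * n)) ^ p))
      with (INR n * ((k * 2 ^ (n * n)) ^ p)) by (rewrite Rpow_mult_distr; ring).
    do 2 f_equal; unfold k; rewrite pow_inv; field; apply pow_nonzero; lra. }
assert (k ^ p * (INR n * (2 ^ (n * n)) ^ p) <=
  k ^ p * Rabs (Derive_n g p (fst (z n)))).
{ apply Rmult_le_compat_l; [apply pow_le|]; lra. }
lra.
Qed.

(** * Separately smooth functions with bounded pure derivatives *)

Record bismooth (G : R -> R -> R) : Prop := {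
  bismooth_l : forall u, smooth (fun t => G t u);
  bismooth_r : forall t, smooth (G t);
  bismooth_bound_l : forall p, loc_bounded (fun t u => Derive_n (fun x => G x u) p t);
  bismooth_bound_r : forall p, loc_bounded (fun t u => Derive_n (G t) p u)
}.

Lemma loc_bounded_swap G : loc_bounded G -> loc_bounded (fun t u => G u t).
Proof. intros H A; destruct (H A) as [C HC]; exists C; auto. Qed.

Lemma loc_bounded_pos G A : loc_bounded G -> exists C, 0 < C /\ forall t u,
  Rabs t <= A -> Rabs u <= A -> Rabs (G t u) <= C.
Proof.
intros H; destruct (H A) as [C HC]; exists (Rabs C + 1); split.
- pose proof (Rabs_pos C); lra.
- intros t u Ht Hu; pose proof (HC t u Ht Hu); pose proof (Rle_abs C); lra.
Qed.

Lemma bismooth_swap G : bismooth G -> bismooth (fun t u => G u t).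
Proof.
intros [H1 H2 H3 H4]; split; trivial; intros p.
- exact (loc_bounded_swap _ (H4 p)).
- exact (loc_bounded_swap _ (H3 p)).
Qed.

Lemma curve_smooth_bismooth G : curve_smooth G -> bismooth G.
Proof.
intros H; split.
- intros u; apply (H (fun t => t) (fun _ => u)); [apply smooth_id|apply smooth_const].
- intros t; apply (H (fun _ => t) (fun u => u)); [apply smooth_const|apply smooth_id].
- intros p; now apply curve_smooth_bounded.
- intros p.
  apply (loc_bounded_swap (fun u t => Derive_n (G t) p u)).
  apply (curve_smooth_bounded (fun u t => G t u)).
  intros a b Ha Hb; now apply H.
Qed.

(** Divide the second-order Taylor estimate with step [h] by [h]. The step is the square root of the
    size of [f], so one derivative costs half of the order of smallness. *)
Lemma landau f t h a b : 0 < h -> smooth f ->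
  (forall c, Rabs (c - t) <= h -> Rabs (f c) <= a * (h * h)) ->
  (forall c, Rabs (c - t) <= h -> Rabs (Derive_n f 2 c) <= b) ->
  Rabs (Derive f t) <= (2 * a + b) * h.
Proof.
intros h0 Hf H0 H2.
assert (T : Rabs (f (t + h) - f t - h * Derive f t) <= b * (h * h)).
{ apply taylor2; [exact Hf|]; intros c Hc; apply H2.
  now rewrite (Rabs_pos_eq h) in Hc by lra. }
assert (T1 := H0 t ltac:(rewrite Rminus_diag, Rabs_R0; lra)).
assert (T2 := H0 (t + h) ltac:(replace (t + h - t) with h by ring; rewrite Rabs_pos_eq; lra)).
apply Rmult_le_reg_l with h; [exact h0|].
rewrite <- (Rabs_pos_eq h) at 1 by lra; rewrite <- Rabs_mult.
apply Rabs_le_between in T, T1, T2; apply Rabs_le_between; split; nra.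
Qed.

(** Each derivative halves the exponent of [eps], so [2 ^ p] is the exponent that leaves one factor
    after [p] steps. The interval grows by 1 per step because the Landau step is at most 1. *)
Lemma landau_iter {I : Type} (eps : I -> R) p (phi : I -> R -> R) :
  (forall i, 0 < eps i <= 1) ->
  (forall i, smooth (phi i)) ->
  (forall j, cpt_bounded (fun i => Derive_n (phi i) j)) ->
  (forall A, exists C, forall i t, Rabs t <= A ->
    Rabs (phi i t) <= C * eps i ^ (2 ^ p)) ->
  forall A, exists C, forall i t, Rabs t <= A ->
    Rabs (Derive_n (phi i) p t) <= C * eps i.
Proof.
intros He; revert phi; induction p as [|p IHp]; intros phi Hs Hb H.
- intros A; destruct (H A) as [C HC]; exists C; intros i t Ht.
  specialize (HC i t Ht); simpl in HC; now rewrite Rmult_1_r in HC.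
- intros A.
  destruct (IHp (fun i => Derive (phi i))) with (A := A) as [C HC].
  + intros i; now apply smooth_Derive.
  + intros j B; destruct (Hb (S j) B) as [C HC]; exists C; intros i t Ht.
    rewrite Derive_n_Derive; auto.
  + intros B; destruct (H (B + 1)) as [C0 HC0], (Hb 2%nat (B + 1)) as [C2 HC2].
    exists (2 * C0 + C2); intros i t Ht.
    set (h := eps i ^ 2 ^ p).
    assert (h0 : 0 < h) by (apply pow_lt; apply He).
    assert (h1 : h <= 1).
    { rewrite <- (pow1 (2 ^ p)); apply pow_incr; destruct (He i); lra. }
    assert (Hc : forall c, Rabs (c - t) <= h -> Rabs c <= B + 1).
    { intros c Hc; replace c with (t + (c - t)) by ring.
      eapply Rle_trans; [apply Rabs_triang|lra]. }
    apply landau; auto; intros c Hct.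
    replace (h * h) with (eps i ^ 2 ^ S p); [auto|].
    unfold h; rewrite <- pow_add; f_equal; simpl; lia.
  + exists C; intros i t Ht; rewrite <- Derive_n_Derive; auto.
Qed.

(** * Difference quotients of high order and the closure of [bismooth] under derivatives *)

(** Richardson extrapolation of the difference [F 1 - F 0] by halving the step. The coefficients
    keep the value 1 on [x] and cancel [x ^ (m + 2)], the lowest power that [stencil m] leaves. *)
Fixpoint stencil (n : nat) (F : R -> R) : R :=
  match n with
  | O => 1 * F 1 + -1 * F 0
  | S m => 2 ^ (m + 2) / (2 ^ (m + 1) - 1) * stencil m (fun x => F (/ 2 * x)) +
           - / (2 ^ (m + 1) - 1) * stencil m F
  end.

Lemma stencil_lin n F H a b :
  stencil n (fun x => a * F x + b * H x) = a * stencil n F + b * stencil n H.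
Proof.
revert F H; induction n as [|n IHn]; intros F H; simpl; [ring|].
rewrite (IHn F H), (IHn (fun x => F (/ 2 * x)) (fun x => H (/ 2 * x))); ring.
Qed.

Lemma stencil_bounded n : exists K, 0 <= K /\ forall F C,
  (forall x, 0 <= x <= 1 -> Rabs (F x) <= C) -> Rabs (stencil n F) <= K * C.
Proof.
assert (T : forall a b x y M, Rabs x <= M -> Rabs y <= M ->
  Rabs (a * x + b * y) <= (Rabs a + Rabs b) * M).
{ intros a b x y M Hx Hy; eapply Rle_trans; [apply Rabs_triang|].
  rewrite !Rabs_mult, Rmult_plus_distr_r.
  apply Rplus_le_compat; (apply Rmult_le_compat_l; [apply Rabs_pos|assumption]). }
induction n as [|n [K [K0 HK]]].
- exists (Rabs 1 + Rabs (-1)); split; [apply Rplus_le_le_0_compat; apply Rabs_pos|].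
  intros F C H; apply T; apply H; lra.
- eexists; split; cycle 1.
  + intros F C H; simpl; eapply Rle_trans; [apply T|].
    * apply (HK _ C); intros x Hx; apply H; lra.
    * apply (HK _ C); exact H.
    * rewrite <- Rmult_assoc; apply Rle_refl.
  + apply Rmult_le_pos; [apply Rplus_le_le_0_compat; apply Rabs_pos|exact K0].
Qed.

Lemma stencil_monomial n j : (j <= n + 1)%nat ->
  stencil n (fun x => x ^ j) = if Nat.eqb j 1 then 1 else 0.
Proof.
induction n as [|n IHn]; intros Hj.
- destruct j as [|[|j]]; [simpl; ring|simpl; ring|lia].
- assert (P : 2 <= 2 ^ (n + 1)).
  { rewrite Nat.add_1_r; simpl; assert (1 <= 2 ^ n) by (apply pow_R1_Rle; lra); lra. }
  assert (E : stencil n (fun x => (/ 2 * x) ^ j) = (/ 2) ^ j * stencil n (fun x => x ^ j)).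
  { rewrite <- (Rplus_0_r (_ * _)), <- (Rmult_0_l (stencil n (fun x => x ^ j))), <- stencil_lin.
    f_equal; apply functional_extensionality; intros x; rewrite Rpow_mult_distr; ring. }
  simpl stencil; rewrite E.
  (* For [j = n + 2] the induction hypothesis is silent, but the two occurrences of [stencil n]
     cancel whatever their value is. *)
  destruct (Nat.eq_dec j (n + 2)) as [->|Hn].
  + replace (n + 2 =? 1) with false by (symmetry; apply Nat.eqb_neq; lia).
    rewrite pow_inv; field; split; [|apply pow_nonzero]; lra.
  + rewrite IHn by lia; destruct (Nat.eqb_spec j 1) as [Ej|_]; [rewrite Ej|ring].
    replace (n + 2)%nat with (S (n + 1)) by lia; rewrite <- tech_pow_Rmult, pow_1.
    field; lra.
Qed.

Lemma stencil_poly n c M : (M <= n + 1)%nat ->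
  stencil n (fun x => sum_f_R0 (fun j => c j * x ^ j) M) =
  if Nat.eqb M 0 then 0 else c 1%nat.
Proof.
induction M as [|M IHM]; intros HM.
- assert (E := stencil_lin n (fun x => x ^ 0) (fun x => x ^ 0) (c 0%nat) 0).
  rewrite stencil_monomial in E by lia; simpl in E |- *.
  replace (stencil n (fun _ => c 0%nat * 1))
    with (stencil n (fun _ => c 0%nat * 1 + 0 * 1)); [rewrite E; ring|].
  f_equal; apply functional_extensionality; intros x; ring.
- assert (E := stencil_lin n (fun x => sum_f_R0 (fun j => c j * x ^ j) M)
    (fun x => x ^ S M) 1 (c (S M))).
  rewrite stencil_monomial, IHM in E by lia.
  replace (stencil n (fun x => sum_f_R0 (fun j => c j * x ^ j) (S M)))
    with (stencil n (fun x => 1 * sum_f_R0 (fun j => c j * x ^ j) M + c (S M) * x ^ S M)).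
  + rewrite E; destruct M; simpl; ring.
  + f_equal; apply functional_extensionality; intros x; simpl; ring.
Qed.

(** On the Taylor polynomial of degree [n + 1] at [u] the stencil returns exactly [k * Derive f u],
    so only the Lagrange remainder has to be estimated. *)
Lemma stencil_taylor n : exists K, 0 <= K /\ forall f u k C, smooth f -> 0 < k ->
  (forall c, u <= c <= u + k -> Rabs (Derive_n f (n + 2) c) <= C) ->
  Rabs (stencil n (fun x => f (u + k * x)) - k * Derive f u) <= K * (C * k ^ (n + 2)).
Proof.
destruct (stencil_bounded n) as [K [K0 HK]]; exists K; split; [exact K0|].
intros f u k C Hf k0 HC.
set (c j := k ^ j / INR (Factorial.fact j) * Derive_n f j u).
set (P x := sum_f_R0 (fun j => c j * x ^ j) (n + 1)).
assert (E : k * Derive f u = stencil n P).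
{ unfold P; rewrite stencil_poly by lia.
  replace (n + 1 =? 0) with false by (symmetry; apply Nat.eqb_neq; lia).
  unfold c; change (Derive f u) with (Derive_n f 1 u); rewrite pow_1.
  simpl (INR _); field. }
rewrite E.
replace (stencil n (fun x => f (u + k * x)) - stencil n P)
  with (stencil n (fun x => 1 * f (u + k * x) + -1 * P x))
  by (rewrite stencil_lin; ring).
apply HK; intros x [x0 x1].
assert (C0 : 0 <= C).
{ eapply Rle_trans; [apply Rabs_pos|apply (HC u); lra]. }
assert (k2 : 0 < k ^ (n + 2)) by now apply pow_lt.
(* [Taylor_Lagrange] requires distinct end points, so the node 0 is treated apart; there [f] and its
   Taylor polynomial agree. *)
destruct (Rle_lt_or_eq_dec _ _ x0) as [xp|<-].
- destruct (Taylor_Lagrange f (n + 1) u (u + k * x)) as [z [Hz ->]].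
  + assert (0 < k * x) by now apply Rmult_lt_0_compat. lra.
  + intros t _ j _; apply Hf.
  + replace (u + k * x - u) with (k * x) by ring.
    replace (S (n + 1)) with (n + 2)%nat by lia.
    assert (EP : sum_f_R0 (fun m => (k * x) ^ m / INR (Factorial.fact m) * Derive_n f m u) (n + 1)
      = P x).
    { apply sum_eq; intros i _; unfold c; rewrite Rpow_mult_distr; field; apply INR_fact_neq_0. }
    rewrite EP.
    replace (1 * (P x + (k * x) ^ (n + 2) / INR (Factorial.fact (n + 2)) *
        Derive_n f (n + 2) z) + -1 * P x)
      with (Derive_n f (n + 2) z * (k ^ (n + 2) * (x ^ (n + 2) / INR (Factorial.fact (n + 2)))))
      by (rewrite Rpow_mult_distr; field; apply INR_fact_neq_0).
    assert (x2 : 0 <= x ^ (n + 2) <= 1).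
    { split; [now apply pow_le|]; rewrite <- (pow1 (n + 2)); now apply pow_incr. }
    assert (F1 : 1 <= INR (Factorial.fact (n + 2))).
    { change 1 with (INR 1); apply le_INR, Factorial.lt_O_fact. }
    assert (Q : 0 <= x ^ (n + 2) / INR (Factorial.fact (n + 2)) <= 1).
    { split; [apply Rdiv_le_0_compat; lra|].
      apply Rmult_le_reg_r with (INR (Factorial.fact (n + 2))); [lra|].
      unfold Rdiv; rewrite Rmult_assoc, Rinv_l; lra. }
    rewrite Rabs_mult; apply Rmult_le_compat; [apply Rabs_pos|apply Rabs_pos| |].
    * apply HC; assert (k * x <= k * 1) by (apply Rmult_le_compat_l; lra). lra.
    * rewrite Rabs_pos_eq by (apply Rmult_le_pos; lra).
      rewrite <- (Rmult_1_r (k ^ (n + 2))) at 2; apply Rmult_le_compat_l; lra.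
- replace (1 * f (u + k * 0) + -1 * P 0) with 0; [rewrite Rabs_R0; apply Rmult_le_pos; lra|].
  rewrite Rmult_0_r, Rplus_0_r; unfold P.
  replace (sum_f_R0 (fun j => c j * 0 ^ j) (n + 1)) with (f u); [ring|].
  generalize (n + 1)%nat; intros m; induction m as [|m IHm]; simpl.
  + unfold c; simpl; field.
  + rewrite <- IHm; ring.
Qed.

Lemma stencil_smooth n (H : R -> R -> R) : (forall x, smooth (H x)) ->
  smooth (fun t => stencil n (fun x => H x t)) /\
  forall p, Derive_n (fun t => stencil n (fun x => H x t)) p =
    (fun t => stencil n (fun x => Derive_n (H x) p t)).
Proof.
revert H; induction n as [|n IHn]; intros H Hs; simpl.
- split; [now apply smooth_lin|].
  intros p; now rewrite (Derive_n_lin (H 1) (H 0)).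
- destruct (IHn H Hs) as [S1 D1].
  destruct (IHn (fun x => H (/ 2 * x)) (fun x => Hs _)) as [S2 D2].
  split; [now apply smooth_lin|].
  intros p.
  rewrite (Derive_n_lin (fun t => stencil n (fun x => H (/ 2 * x) t))
    (fun t => stencil n (fun x => H x t))) by trivial.
  now rewrite D1, D2.
Qed.

(* For a fixed [P], a stencil of high order makes the dyadic difference
   quotients of [G] in the second variable converge so fast that, by [landau],
   their [t]-derivatives of order at most [P] stay bounded. *)
Lemma bismooth_Derive_aux G P B : bismooth G ->
  forall A, exists C, forall u, Rabs u <= B ->
    smooth_upto P (fun t => Derive (G t) u) /\
    forall p t, (p <= P)%nat -> Rabs t <= A ->
      Rabs (Derive_n (fun t => Derive (G t) u) p t) <= C.
Proof.
intros [Gl Gr Bl Br].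
(* The stencil error [h ^ (n + 2)] is then the power [2 ^ S P] of [h * h], which [landau_iter] turns
   into [h * h] after up to [S P] derivatives. Order [S P] is what [limit_smooth_upto P] asks
   for. *)
set (n := (2 * 2 ^ S P - 2)%nat).
assert (Hn : (n + 2 = 2 * 2 ^ S P)%nat).
{ unfold n; assert (2 ^ S P <> 0)%nat by (apply Nat.pow_nonzero; lia); lia. }
destruct (stencil_bounded n) as [K [K0 HK]].
destruct (stencil_taylor n) as [K' [K'0 HK']].
(* The point [u] is part of the index, which makes all constants uniform in [u]. *)
set (I := (nat * {u : R | Rabs u <= B})%type).
set (k := fun m : nat => (/ 2) ^ m).
assert (k0 : forall m, 0 < k m <= 1).
{ intros m; split; [apply pow_lt; lra|].
  rewrite <- (pow1 m); apply pow_incr; lra. }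
set (T := fun (u h t : R) => stencil n (fun x => G t (u + h * x))).
assert (ST : forall u h, smooth (T u h)) by (intros u h; apply stencil_smooth; auto).
assert (DT : forall u h p, Derive_n (T u h) p =
  (fun t => stencil n (fun x => Derive_n (fun s => G s (u + h * x)) p t))).
{ intros u h p; unfold T.
  apply (stencil_smooth n (fun x t => G t (u + h * x))); auto. }
assert (BT : forall p A, exists C, 0 < C /\ forall u h t, Rabs u <= B -> 0 < h <= 1 ->
  Rabs t <= A -> Rabs (Derive_n (T u h) p t) <= K * C).
{ intros p A; destruct (loc_bounded_pos _ (Rmax A (B + 1)) (Bl p)) as [C [C0 HC]].
  exists C; split; [exact C0|]; intros u h t Hu Hh Ht; rewrite DT; apply HK.
  intros x Hx; apply HC.
  - apply Rle_trans with (2 := Rmax_l _ _); exact Ht.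
  - apply Rle_trans with (2 := Rmax_r _ _).
    eapply Rle_trans; [apply Rabs_triang|]; apply Rplus_le_compat; [exact Hu|].
    rewrite Rabs_pos_eq; [|apply Rmult_le_pos; lra].
    rewrite <- (Rmult_1_l 1); apply Rmult_le_compat; lra. }
assert (TT : forall A, exists C, 0 < C /\ forall u h t, Rabs u <= B -> 0 < h <= 1 ->
  Rabs t <= A -> Rabs (T u h t - h * Derive (G t) u) <= C * h ^ (n + 2)).
{ intros A; destruct (loc_bounded_pos _ (Rmax A (B + 1)) (Br (n + 2)%nat)) as [C [C0 HC]].
  exists ((K' + 1) * C); split; [apply Rmult_lt_0_compat; lra|].
  intros u h t Hu Hh Ht.
  apply Rle_trans with (K' * (C * h ^ (n + 2))).
  - apply HK'; [apply Gr|lra|]; intros c Hc; apply HC.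
    + apply Rle_trans with (2 := Rmax_l _ _); exact Ht.
    + apply Rle_trans with (2 := Rmax_r _ _).
      apply Rabs_le_between in Hu; apply Rabs_le_between; lra.
  - rewrite Rmult_assoc; apply Rmult_le_compat_r; [|lra].
    apply Rmult_le_pos; [lra|apply pow_le; lra]. }
set (phi := fun (u : R) (m : nat) (t : R) => 2 ^ m * T u (k m) t + 0 * 0).
(* [2 ^ m * e (m, u)] is the increment from [phi u m] to [phi u (S m)]. The leading terms
   [h * Derive (G t) u] cancel in [e], since [k (S m)] is half of [k m]. *)
set (e := fun (i : I) (t : R) =>
  2 * T (proj1_sig (snd i)) (k (S (fst i))) t +
  -1 * T (proj1_sig (snd i)) (k (fst i)) t).
assert (Se : forall i, smooth (e i)) by (intros i; now apply smooth_lin).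
assert (De : forall i p t, Derive_n (e i) p t =
  2 * Derive_n (T (proj1_sig (snd i)) (k (S (fst i)))) p t +
  -1 * Derive_n (T (proj1_sig (snd i)) (k (fst i))) p t).
{ intros i p t; unfold e; now rewrite Derive_n_lin. }
assert (kk : forall m, 2 ^ m * k m = 1).
{ intros m; unfold k; rewrite <- Rpow_mult_distr, Rinv_r, pow1; lra. }
assert (kS : forall m, k (S m) = / 2 * k m) by reflexivity.
(* The square is essential: multiplied by [2 ^ m] it still leaves [k m], which is summable. *)
assert (Q : forall p A, (p <= S P)%nat -> exists C, forall i t, Rabs t <= A ->
  Rabs (Derive_n (e i) p t) <= C * (k (fst i) * k (fst i))).
{ intros p A Hp.
  apply (landau_iter (fun i : I => k (fst i) * k (fst i))).
  - intros i; specialize (k0 (fst i)); nra.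
  - exact Se.
  - intros j A'; destruct (BT j A') as [C [C0 HC]]; exists (3 * (K * C)).
    intros [m [u Hu]] t Ht; rewrite De; simpl fst; simpl snd; simpl proj1_sig.
    pose proof (HC u _ t Hu (k0 (S m)) Ht) as H1.
    pose proof (HC u _ t Hu (k0 m) Ht) as H2.
    apply Rabs_le_between in H1, H2; apply Rabs_le_between; lra.
  - intros A'; destruct (TT A') as [C [C0 HC]]; exists (3 * C).
    intros [m [u Hu]] t Ht; unfold e; simpl fst; simpl snd; simpl proj1_sig.
    pose proof (HC u _ t Hu (k0 (S m)) Ht) as H1.
    pose proof (HC u _ t Hu (k0 m) Ht) as H2.
    rewrite kS in H1 at 2.
    assert (L1 : k (S m) ^ (n + 2) <= k m ^ (n + 2)).
    { apply pow_incr; rewrite kS; specialize (k0 m); lra. }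
    apply Rle_trans with (3 * C * k m ^ (n + 2)).
    + assert (L2 : C * k (S m) ^ (n + 2) <= C * k m ^ (n + 2))
        by (apply Rmult_le_compat_l; lra).
      apply Rabs_le_between in H1, H2; apply Rabs_le_between; split; lra.
    + apply Rmult_le_compat_l; [lra|].
      rewrite Hn, pow_mult.
      replace (k m ^ 2) with (k m * k m) by ring.
      assert (S0 : 0 < k m * k m <= 1) by (specialize (k0 m); nra).
      replace (2 ^ S P)%nat with (2 ^ p + (2 ^ S P - 2 ^ p))%nat
        by (pose proof (Nat.pow_le_mono_r 2 p (S P) ltac:(lia) Hp); lia).
      rewrite pow_add; apply Rle_trans with ((k m * k m) ^ 2 ^ p * 1);
        [|rewrite Rmult_1_r; apply Rle_refl].
      apply Rmult_le_compat_l; [apply pow_le; lra|].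
      rewrite <- (pow1 (2 ^ S P - 2 ^ p)); apply pow_incr; lra. }
assert (Sphi : forall u m, smooth (phi u m)).
{ intros u m; apply (smooth_lin (T u (k m)) (fun _ => 0)); [apply ST|apply smooth_const]. }
assert (Dphi : forall u m p t, Derive_n (phi u m) p t = 2 ^ m * Derive_n (T u (k m)) p t).
{ intros u m p t; unfold phi.
  rewrite (Derive_n_lin (T u (k m)) (fun _ => 0)); [ring|apply ST|apply smooth_const]. }
assert (Bphi : forall p A, (p <= S P)%nat -> exists C, forall u m t, Rabs u <= B ->
  Rabs t <= A -> Rabs (Derive_n (phi u m) p t) <= C).
{ intros p A Hp; destruct (Q p A Hp) as [C HC], (BT p A) as [C0 [_ HC0]].
  (* Telescoping: the increments are at most [C * k m], and [2 - 2 * k m] is the sum of the earlier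
     [k]. *)
  assert (R : forall u m t, Rabs u <= B -> Rabs t <= A ->
    Rabs (Derive_n (phi u m) p t) <= K * C0 + C * (2 - 2 * k m)).
  { intros u m t Hu Ht; induction m as [|m IHm].
    - rewrite Dphi; unfold k at 2; simpl (2 ^ 0); simpl ((/ 2) ^ 0).
      rewrite Rmult_1_l; pose proof (HC0 u (k 0%nat) t Hu (k0 0%nat) Ht); lra.
    - assert (X := HC (m, exist _ u Hu) t Ht).
      rewrite De in X; simpl fst in X; simpl snd in X; simpl proj1_sig in X.
      rewrite Dphi in IHm |- *.
      set (a := Derive_n (T u (k (S m))) p t) in *.
      set (b := Derive_n (T u (k m)) p t) in *.
      replace (2 ^ S m * a) with (2 ^ m * b + 2 ^ m * (2 * a + -1 * b))
        by (rewrite <- tech_pow_Rmult; ring).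
      eapply Rle_trans; [apply Rabs_triang|].
      rewrite (Rabs_mult (2 ^ m) (2 * a + _)), (Rabs_pos_eq (2 ^ m)) by (apply pow_le; lra).
      assert (Y : 2 ^ m * Rabs (2 * a + -1 * b) <= 2 ^ m * (C * (k m * k m)))
        by (apply Rmult_le_compat_l; [apply pow_le; lra|exact X]).
      replace (2 ^ m * (C * (k m * k m))) with (C * k m * (2 ^ m * k m)) in Y by ring.
      rewrite kk in Y; rewrite kS; lra. }
  exists (K * C0 + 2 * Rabs C); intros u m t Hu Ht.
  apply Rle_trans with (1 := R u m t Hu Ht); apply Rplus_le_compat_l.
  specialize (k0 m); pose proof (Rle_abs C); pose proof (Rabs_pos C); nra. }
assert (Lphi : forall u t, Rabs u <= B ->
  is_lim_seq (fun m => phi u m t) (Derive (G t) u)).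
{ intros u t Hu; destruct (TT (Rabs t)) as [C [C0 HC]].
  apply is_lim_seq_le_le with (fun m => Derive (G t) u - C * k m)
    (fun m => Derive (G t) u + C * k m).
  - intros m; specialize (HC u (k m) t Hu (k0 m) (Rle_refl _)).
    assert (P0 : 0 < 2 ^ m) by (apply pow_lt; lra).
    apply (Rmult_le_compat_l (2 ^ m)) in HC; [|lra].
    rewrite <- (Rabs_pos_eq (2 ^ m)), <- Rabs_mult, (Rabs_pos_eq (2 ^ m)) in HC by lra.
    replace (2 ^ m * (T u (k m) t - k m * Derive (G t) u))
      with (phi u m t - 2 ^ m * k m * Derive (G t) u) in HC by (unfold phi; ring).
    replace (2 ^ m * (C * k m ^ (n + 2))) with (C * (2 ^ m * k m * (k m * k m ^ n))) in HC
      by (rewrite pow_add; ring).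
    rewrite kk in HC.
    assert (k m * k m ^ n <= k m).
    { rewrite <- (Rmult_1_r (k m)) at 3; specialize (k0 m).
      apply Rmult_le_compat_l; [lra|].
      rewrite <- (pow1 n); apply pow_incr; lra. }
    apply (Rmult_le_compat_l C) in H; [|lra].
    apply Rabs_le_between in HC; lra.
  - rewrite <- (Rminus_0_r (Derive (G t) u)) at 1; rewrite <- (Rmult_0_r C).
    apply is_lim_seq_minus'; [apply is_lim_seq_const|].
    apply (is_lim_seq_scal_l k C (Finite 0)), is_lim_seq_geom; rewrite Rabs_pos_eq; lra.
  - rewrite <- (Rplus_0_r (Derive (G t) u)) at 1; rewrite <- (Rmult_0_r C).
    apply is_lim_seq_plus'; [apply is_lim_seq_const|].
    apply (is_lim_seq_scal_l k C (Finite 0)), is_lim_seq_geom; rewrite Rabs_pos_eq; lra. }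
assert (LS : forall u, Rabs u <= B -> smooth_upto P (fun t => Derive (G t) u) /\
  forall p t, (p <= P)%nat -> is_lim_seq (fun m => Derive_n (phi u m) p t)
    (Derive_n (fun t => Derive (G t) u) p t)).
{ intros u Hu; apply limit_smooth_upto; [apply Sphi| |auto].
  intros p Hp A'; destruct (Bphi p A' Hp) as [C HC]; exists C; intros m t Ht; auto. }
intros A.
assert (UB : exists C, forall p u m t, (p <= P)%nat -> Rabs u <= B ->
  Rabs t <= A -> Rabs (Derive_n (phi u m) p t) <= C).
{ assert (W : forall P', (P' <= P)%nat -> exists C, forall p u m t, (p <= P')%nat ->
    Rabs u <= B -> Rabs t <= A -> Rabs (Derive_n (phi u m) p t) <= C).
  { intros P'; induction P' as [|P' IH]; intros HP'.
    - destruct (Bphi 0%nat A ltac:(lia)) as [C HC]; exists C; intros p u m t Hp.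
      replace p with 0%nat by lia; auto.
    - destruct (IH ltac:(lia)) as [C HC], (Bphi (S P') A ltac:(lia)) as [C' HC'].
      exists (Rmax C C'); intros p u m t Hp Hu Ht.
      destruct (Nat.eq_dec p (S P')) as [->|Hne].
      + apply Rle_trans with (2 := Rmax_r _ _); auto.
      + apply Rle_trans with (2 := Rmax_l _ _); apply HC; trivial; lia. }
  now apply W. }
destruct UB as [C HC]; exists C; intros u Hu; split; [now apply LS|].
intros p t Hp Ht; destruct (LS u Hu) as [_ L].
apply lim_seq_Rabs_le with (1 := L p t Hp); auto.
Qed.

(** The decisive closure property: bounds on pure derivatives are assumed, and applying the lemma
    repeatedly yields all mixed ones. *)
Lemma bismooth_Derive_r G : bismooth G -> bismooth (fun t u => Derive (G t) u).
Proof.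
intros HG; assert (HG' := HG); destruct HG' as [Gl Gr Bl Br]; split.
- intros u; apply smooth_uptoP; intros P.
  destruct (bismooth_Derive_aux G P (Rabs u) HG 0) as [C HC]; apply HC, Rle_refl.
- intros t; apply smooth_Derive, Gr.
- intros p A; destruct (bismooth_Derive_aux G p A HG A) as [C HC].
  exists C; intros t u Ht Hu; now apply (HC u Hu).
- intros p A; destruct (Br (S p) A) as [C HC].
  exists C; intros t u Ht Hu; change (Rabs (Derive_n (Derive (G t)) p u) <= C).
  rewrite Derive_n_Derive; auto.
Qed.

Lemma bismooth_Derive_l G : bismooth G ->
  bismooth (fun t u => Derive (fun s => G s u) t).
Proof.
intros HG.
exact (bismooth_swap _ (bismooth_Derive_r _ (bismooth_swap _ HG))).
Qed.

Lemma bismooth_continuity G x y : bismooth G -> continuity_2d_pt G x y.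
Proof.
intros [Gl Gr Bl Br] eps.
destruct (loc_bounded_pos _ (Rabs x + Rabs y + 1) (Bl 1%nat)) as [C [C0 HC]].
destruct (loc_bounded_pos _ (Rabs x + Rabs y + 1) (Br 1%nat)) as [D [D0 HD]].
assert (d0 : 0 < Rmin 1 (eps / (C + D))).
{ apply Rmin_pos; [lra|]; apply Rdiv_lt_0_compat; [apply cond_pos|lra]. }
exists (mkposreal _ d0); intros u v Hu Hv; simpl in Hu, Hv.
set (d := Rmin 1 (eps / (C + D))) in *.
assert (d1 : d <= 1) by apply Rmin_l.
assert (d2 : (C + D) * d <= eps).
{ replace (pos eps) with ((C + D) * (eps / (C + D))) by (field; lra).
  apply Rmult_le_compat_l; [lra|apply Rmin_r]. }
assert (N : forall a b c, Rabs (b - a) < d -> Rmin a b <= c <= Rmax a b ->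
  Rabs c <= Rabs a + 1).
{ intros a b c Hab Hc; apply Rabs_sub_between in Hc.
  replace c with (a + (c - a)) by ring; eapply Rle_trans; [apply Rabs_triang|lra]. }
assert (Hx := Rabs_pos x); assert (Hy := Rabs_pos y).
replace (G u v - G x y) with ((G u v - G x v) + (G x v - G x y)) by ring.
eapply Rle_lt_trans; [apply Rabs_triang|].
assert (L1 : Rabs (G u v - G x v) <= C * Rabs (u - x)).
{ apply (lipschitz_bound (fun t => G t v) x u); [apply Gl|].
  intros c Hc; apply HC; [pose proof (N x u c Hu Hc); lra|].
  pose proof (N y v v Hv (conj (Rmin_r _ _) (Rmax_r _ _))); lra. }
assert (L2 : Rabs (G x v - G x y) <= D * Rabs (v - y)).
{ apply (lipschitz_bound (G x) y v); [apply Gr|].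
  intros c Hc; apply HD; [lra|]; pose proof (N y v c Hv Hc); lra. }
assert (C * Rabs (u - x) < C * d) by (apply Rmult_lt_compat_l; lra).
assert (D * Rabs (v - y) < D * d) by (apply Rmult_lt_compat_l; lra).
lra.
Qed.

Lemma bismooth_schwarz G x y : bismooth G ->
  Derive (fun z => Derive (fun t => G z t) y) x =
  Derive (fun z => Derive (fun t => G t z) x) y.
Proof.
intros HG; assert (Hr := bismooth_Derive_r G HG); assert (Hl := bismooth_Derive_l G HG).
apply Schwarz.
- exists (mkposreal 1 Rlt_0_1); intros u v _ _; repeat split.
  + exact (smooth_ex_derive _ (bismooth_l _ HG v) u).
  + exact (smooth_ex_derive _ (bismooth_r _ HG u) v).
  + exact (smooth_ex_derive _ (bismooth_l _ Hr v) u).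
  + exact (smooth_ex_derive _ (bismooth_r _ Hl u) v).
- exact (bismooth_continuity _ x y (bismooth_Derive_l _ Hr)).
- exact (bismooth_continuity _ x y (bismooth_Derive_r _ Hl)).
Qed.

Lemma bismooth_differentiable G x y : bismooth G ->
  differentiable_pt_lim G x y (Derive (fun t => G t y) x) (Derive (G x) y).
Proof.
intros HG eps; assert (HG' := HG); destruct HG' as [Gl Gr _ _].
assert (E2 : 0 < eps / 2) by (pose proof (cond_pos eps); lra).
destruct (bismooth_continuity _ x y (bismooth_Derive_l _ HG) (mkposreal _ E2)) as [d1 H1].
destruct (bismooth_continuity _ x y (bismooth_Derive_r _ HG) (mkposreal _ E2)) as [d2 H2].
simpl in H1, H2.
assert (d0 : 0 < Rmin d1 d2) by (apply Rmin_pos; apply cond_pos).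
exists (mkposreal _ d0); intros u v Hu Hv; simpl in Hu, Hv.
assert (Hu1 := Rlt_le_trans _ _ _ Hu (Rmin_l d1 d2)).
assert (Hv1 := Rlt_le_trans _ _ _ Hv (Rmin_l d1 d2)).
assert (Hv2 := Rlt_le_trans _ _ _ Hv (Rmin_r d1 d2)).
destruct (mean_value (fun t => G t v) x u (Gl v)) as [c [Hc Ec]].
destruct (mean_value (G x) y v (Gr x)) as [c' [Hc' Ec']].
apply Rabs_sub_between in Hc, Hc'.
specialize (H1 c v ltac:(lra) Hv1).
specialize (H2 x c' ltac:(rewrite Rminus_diag, Rabs_R0; apply cond_pos) ltac:(lra)).
set (p := Derive (fun t => G t y) x) in *; set (q := Derive (G x) y) in *.
replace (G u v - G x y - (p * (u - x) + q * (v - y)))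
  with ((Derive (fun t => G t v) c - p) * (u - x) + (Derive (G x) c' - q) * (v - y))
  by (replace (G u v - G x y) with ((G u v - G x v) + (G x v - G x y)) by ring;
      rewrite Ec, Ec'; ring).
eapply Rle_trans; [apply Rabs_triang|]; rewrite !Rabs_mult.
set (M := Rmax (Rabs (u - x)) (Rabs (v - y))).
replace (eps * M) with (eps / 2 * M + eps / 2 * M) by field.
apply Rplus_le_compat; apply Rmult_le_compat; try apply Rabs_pos;
  try (now left); [apply Rmax_l|apply Rmax_r].
Qed.

Lemma bismooth_chain G a b t : bismooth G -> smooth a -> smooth b ->
  is_derive (fun t => G (a t) (b t)) t
    (Derive (fun s => G s (b t)) (a t) * Derive a t + Derive (G (a t)) (b t) * Derive b t).
Proof.
intros HG Ha Hb; apply is_derive_Reals.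
apply (derivable_pt_lim_comp_2d G a b t _ _ (Derive a t) (Derive b t)).
- now apply bismooth_differentiable.
- apply is_derive_Reals, Derive_correct; now apply smooth_ex_derive.
- apply is_derive_Reals, Derive_correct; now apply smooth_ex_derive.
Qed.

(** The chain rule expresses the derivative through the two partial derivatives, which are again
    [bismooth]; hence the induction over all [G] at once. *)
Lemma bismooth_curve_smooth G : bismooth G -> curve_smooth G.
Proof.
intros HG a b Ha Hb; apply smooth_uptoP; intros n; revert G HG.
induction n as [|n IHn]; intros G HG; [exact I|]; split.
- intros t; eexists; now apply bismooth_chain.
- replace (Derive (fun t => G (a t) (b t))) with
    (fun t => Derive (fun s => G s (b t)) (a t) * Derive a t +
              Derive (G (a t)) (b t) * Derive b t).
  + apply smooth_upto_plus; apply smooth_upto_mult.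
    * apply (IHn (fun t u => Derive (fun s => G s u) t)); now apply bismooth_Derive_l.
    * now apply smooth_uptoP, smooth_Derive.
    * apply (IHn (fun t u => Derive (G t) u)); now apply bismooth_Derive_r.
    * now apply smooth_uptoP, smooth_Derive.
  + apply functional_extensionality; intros t.
    symmetry; apply is_derive_unique; now apply bismooth_chain.
Qed.

Lemma curve_smooth_Derive_r G : curve_smooth G ->
  curve_smooth (fun t u => Derive (G t) u).
Proof.
intros HG; apply bismooth_curve_smooth, bismooth_Derive_r.
now apply curve_smooth_bismooth.
Qed.

(** * Uniform boundedness *)

Lemma funct_curve (X : frolicher) f c : funct X f -> curve X c ->
  smooth (fun t => f (c t)).
Proof. intros Hf; now apply functP. Qed.

Lemma funct_lin (X : frolicher) f g a b : funct X f -> funct X g ->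
  funct X (fun x => a * f x + b * g x).
Proof.
intros Hf Hg; apply functP; intros c Hc.
apply (smooth_lin (fun t => f (c t)) (fun t => g (c t))); now apply funct_curve.
Qed.

Lemma funct_const (X : frolicher) a : funct X (fun _ => a).
Proof. apply functP; intros c _; apply smooth_const. Qed.

Lemma curve_const (X : frolicher) x : curve X (fun _ => x).
Proof. apply curveP; intros f _; exact (smooth_const (f x)). Qed.

Lemma curve_comp (X : frolicher) c a : curve X c -> smooth a ->
  curve X (fun t => c (a t)).
Proof.
intros Hc Ha; apply curveP; intros f Hf.
apply (smooth_comp (fun t => f (c t))); [now apply funct_curve|exact Ha].
Qed.

(** Boundedness for the initial topology of the restrictions along all curves, with values in the
    space of smooth functions on the line. *)
Definition bounded_seq (X : frolicher) (g : nat -> X -> R) : Prop :=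
  (forall k, funct X (g k)) /\
  forall c, curve X c -> forall p, cpt_bounded (fun k => Derive_n (fun r => g k (c r)) p).

Definition linear_functional (X : frolicher) (T : (X -> R) -> R) : Prop :=
  forall f g a b, funct X f -> funct X g ->
    T (fun x => a * f x + b * g x) = a * T f + b * T g.

Definition bounded_functional (X : frolicher) (T : (X -> R) -> R) : Prop :=
  linear_functional X T /\
  forall g, bounded_seq X g -> exists C, forall k, Rabs (T (g k)) <= C.

(** The substitute for completeness. The remainders stay bounded after multiplication by [3 ^ m]:
    such a rate is visible to functionals that are known to be bounded but not known to be
    continuous. Only the size of [s] is prescribed because [hump] chooses its sign. *)
Lemma geometric_series_limit (X : frolicher) (h y : nat -> X -> R) :
  bounded_seq X h ->
  (y 0%nat = fun _ => 0) ->
  (forall m, exists s, Rabs s = (/ 3) ^ m /\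
    y (S m) = fun x => 1 * y m x + s * h m x) ->
  (forall m, funct X (y m)) /\
  exists z, funct X z /\ bounded_seq X (fun m x => 3 ^ m * z x + - 3 ^ m * y m x).
Proof.
intros [Fh Bh] Y0 YS.
assert (Fy : forall m, funct X (y m)).
{ induction m as [|m IHm]; [rewrite Y0; apply funct_const|].
  destruct (YS m) as [s [_ ->]]; now apply funct_lin. }
split; [exact Fy|].
assert (D : forall c p A, curve X c -> exists C, 0 < C /\ forall m K t, (m <= K)%nat ->
  Rabs t <= A ->
  Rabs (Derive_n (fun r => y K (c r)) p t - Derive_n (fun r => y m (c r)) p t)
    <= C * (/ 3) ^ m).
{ intros c p A Hc; destruct (cpt_bounded_pos _ A (Bh c Hc p)) as [C [C0 HC]].
  exists (C * (3 / 2)); split; [lra|]; intros m K t HK Ht.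
  (* [3 / 2] is the sum of the powers of [/ 3], so this is [C] times the sum of [(/ 3) ^ i] for
     [m <= i < K]. *)
  apply Rle_trans with (C * (3 / 2) * ((/ 3) ^ m - (/ 3) ^ K)).
  - induction HK as [|K HK IHK].
    + rewrite !Rminus_diag, Rabs_R0; lra.
    + destruct (YS K) as [s [Es ->]].
      rewrite (Derive_n_lin (fun r => y K (c r)) (fun r => h K (c r)))
        by now apply funct_curve.
      replace (1 * Derive_n (fun r => y K (c r)) p t + s * Derive_n (fun r => h K (c r)) p t
          - Derive_n (fun r => y m (c r)) p t)
        with ((Derive_n (fun r => y K (c r)) p t - Derive_n (fun r => y m (c r)) p t)
          + s * Derive_n (fun r => h K (c r)) p t) by ring.
      eapply Rle_trans; [apply Rabs_triang|]; rewrite Rabs_mult, Es.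
      replace (C * (3 / 2) * ((/ 3) ^ m - (/ 3) ^ S K))
        with (C * (3 / 2) * ((/ 3) ^ m - (/ 3) ^ K) + (/ 3) ^ K * C)
        by (rewrite <- tech_pow_Rmult; field).
      apply Rplus_le_compat; [exact IHK|].
      apply Rmult_le_compat_l; [apply pow_le; lra|auto].
  - apply Rmult_le_compat_l; [lra|].
    assert (0 < (/ 3) ^ K) by (apply pow_lt; lra); lra. }
assert (Z : forall x, ex_finite_lim_seq (fun m => y m x)).
{ intros x; apply ex_lim_seq_cauchy_corr; intros eps.
  destruct (D (fun _ => x) 0%nat 0 (curve_const X x)) as [C [C0 HC]].
  destruct (pow_lt_1_zero (/ 3) ltac:(rewrite Rabs_pos_eq; lra) (eps / (2 * C)))
    as [N HN]; [apply Rdiv_lt_0_compat; [apply cond_pos|lra]|].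
  exists N; intros n m Hn Hm.
  specialize (HN N (le_n N)); rewrite Rabs_pos_eq in HN by (apply pow_le; lra).
  pose proof (HC N n 0 Hn ltac:(rewrite Rabs_R0; lra)) as H1.
  pose proof (HC N m 0 Hm ltac:(rewrite Rabs_R0; lra)) as H2.
  simpl in H1, H2.
  assert (E : C * (/ 3) ^ N < C * (eps / (2 * C))) by (apply Rmult_lt_compat_l; lra).
  replace (C * (eps / (2 * C))) with (eps / 2) in E by (field; lra).
  apply Rabs_le_between in H1, H2; apply Rabs_lt_between; lra. }
destruct (choice _ Z) as [z Hz]; clear Z.
assert (L : forall c, curve X c -> smooth (fun t => z (c t)) /\
  forall p t, is_lim_seq (fun m => Derive_n (fun r => y m (c r)) p t)
    (Derive_n (fun r => z (c r)) p t)).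
{ intros c Hc; apply limit_smooth; [intros m; now apply funct_curve| |auto].
  intros p A; destruct (D c p A Hc) as [C [_ HC]].
  exists C; intros m t Ht; specialize (HC 0%nat m t (Nat.le_0_l m) Ht).
  rewrite Y0 in HC; simpl in HC.
  replace (Derive_n (fun _ => 0) p t) with 0 in HC
    by (destruct p as [|p]; [reflexivity|symmetry; apply Derive_n_const]).
  now rewrite Rminus_0_r, Rmult_1_r in HC. }
assert (Fz : funct X z) by (apply functP; intros c Hc; now apply L).
exists z; split; [exact Fz|]; split; [intros m; now apply funct_lin|].
intros c Hc p A; destruct (D c p A Hc) as [C [C0 HC]]; exists C; intros m t Ht.
rewrite (Derive_n_lin (fun r => z (c r)) (fun r => y m (c r))) by now apply funct_curve.
replace (3 ^ m * Derive_n (fun r => z (c r)) p t + - 3 ^ m * Derive_n (fun r => y m (c r)) p t)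
  with (3 ^ m * (Derive_n (fun r => z (c r)) p t - Derive_n (fun r => y m (c r)) p t))
  by ring.
assert (P : 0 < 3 ^ m) by (apply pow_lt; lra).
rewrite Rabs_mult, (Rabs_pos_eq (3 ^ m)) by lra.
apply Rmult_le_reg_l with (/ 3 ^ m); [now apply Rinv_0_lt_compat|].
rewrite <- Rmult_assoc, Rinv_l, Rmult_1_l, <- pow_inv, Rmult_comm by lra.
apply lim_seq_Rabs_le with (fun K => Derive_n (fun r => y (K + m)%nat (c r)) p t
  - Derive_n (fun r => y m (c r)) p t).
- apply is_lim_seq_minus'; [|apply is_lim_seq_const].
  apply -> (is_lim_seq_incr_n (fun K => Derive_n (fun r => y K (c r)) p t) m).
  now apply L.
- intros K; apply HC; [lia|exact Ht].
Qed.

Fixpoint hump {X : Type} (U : nat -> (X -> R) -> R) (h : nat -> X -> R) (m : nat) : X -> R :=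
  match m with
  | O => fun _ => 0
  | S m => fun x => 1 * hump U h m x +
      (if Rle_dec 0 (U m (hump U h m) * U m (h m)) then (/ 3) ^ m else - (/ 3) ^ m) * h m x
  end.

(* Sokal's form of the gliding hump: at each step the sign of the new term is
   chosen so that it cannot cancel against the previous ones. *)
Lemma uniform_boundedness (X : frolicher) (T : nat -> (X -> R) -> R) (g : nat -> X -> R) :
  (forall n, bounded_functional X (T n)) ->
  (forall f, funct X f -> exists C, forall n, Rabs (T n f) <= C) ->
  bounded_seq X g ->
  exists C, forall n k, Rabs (T n (g k)) <= C.
Proof.
intros HT Hpt Hg; apply NNPP; intros N.
(* The index [k] nearly attains the supremum for the chosen functional, so that functional is also
   under control on every later term. The base 4 must exceed the ratio 3 of the series:
   [(4 / 3) ^ j / 3] gives the final contradiction. *)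
assert (Q : forall j : nat, exists nk : nat * nat,
  4 ^ j <= Rabs (T (fst nk) (g (snd nk))) /\
  forall k, Rabs (T (fst nk) (g k)) <= 4 / 3 * Rabs (T (fst nk) (g (snd nk)))).
{ intros j; apply NNPP; intros N2; apply N; exists (4 / 3 * 4 ^ j); intros n k.
  apply Rnot_lt_le; intros L; apply N2; clear N N2.
  destruct (proj2 (HT n) g Hg) as [C HC].
  destruct (completeness (fun r => exists k, r = Rabs (T n (g k)))) as [S [S1 S2]].
  - exists C; intros r [k' ->]; auto.
  - now exists (Rabs (T n (g k))), k.
  - assert (HS : 4 / 3 * 4 ^ j < S) by (apply Rlt_le_trans with (1 := L), S1; now exists k).
    assert (P : 0 < 4 ^ j) by (apply pow_lt; lra).
    assert (E : exists k', 3 / 4 * S <= Rabs (T n (g k'))).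
    { apply NNPP; intros N; assert (S <= 3 / 4 * S); [|lra].
      apply S2; intros r [k' ->]; apply Rnot_lt_le; intros L'; apply N.
      exists k'; lra. }
    destruct E as [k' Hk']; exists (n, k'); simpl; split; [lra|].
    intros k''; assert (Rabs (T n (g k'')) <= S) by (apply S1; now exists k''); lra. }
destruct (choice _ Q) as [nk Hnk]; clear Q N.
set (U j := T (fst (nk j))); set (h j := g (snd (nk j))).
set (a j := Rabs (U j (h j))).
assert (Ha : forall j, 4 ^ j <= a j) by (intros j; apply Hnk).
assert (Hah : forall j i, Rabs (U j (h i)) <= 4 / 3 * a j) by (intros j i; apply Hnk).
assert (Bh : bounded_seq X h).
{ destruct Hg as [Fg Bg]; split; [intros k; apply Fg|].
  intros c Hc p A; destruct (Bg c Hc p A) as [C HC]; exists C; intros k t; apply HC. }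
set (y := hump U h).
assert (YS : forall m, exists s, Rabs s = (/ 3) ^ m /\
  y (S m) = (fun x => 1 * y m x + s * h m x) /\
  (0 <= s * (U m (y m) * U m (h m)))).
{ intros m; assert (P : 0 < (/ 3) ^ m) by (apply pow_lt; lra).
  unfold y; simpl; destruct (Rle_dec 0 (U m (hump U h m) * U m (h m))) as [H|H];
    eexists; (split; [|split; [reflexivity|]]).
  - apply Rabs_pos_eq; lra.
  - apply Rmult_le_pos; lra.
  - rewrite Rabs_Ropp; apply Rabs_pos_eq; lra.
  - nra. }
destruct (geometric_series_limit X h y Bh eq_refl) as [Fy [z [Fz Bz]]].
{ intros m; destruct (YS m) as [s [H1 [H2 _]]]; now exists s. }
assert (UL : forall j, linear_functional X (U j)) by (intros j; apply HT).
assert (Low : forall j, (/ 3) ^ j * a j <= Rabs (U j (y (S j)))).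
{ intros j; destruct (YS j) as [s [Es [-> Hs]]].
  rewrite (UL j) by (trivial; apply Bh); rewrite Rmult_1_l.
  unfold a; rewrite <- Es, <- Rabs_mult.
  (* In the square of the sum, the cross term is nonnegative by the choice of sign. *)
  apply Rsqr_le_abs_0; unfold Rsqr.
  pose proof (Rle_0_sqr (U j (y j))) as E; unfold Rsqr in E; nra. }
(* The terms after stage [j] sum to at most [4 / 3 * a j] times [3 / 2 * (/ 3) ^ S j], two thirds of
   the lower bound in [Low]; one third survives in [Lz]. *)
assert (Tail : forall j M, (S j <= M)%nat ->
  Rabs (U j (y M) - U j (y (S j))) <= 2 / 3 * ((/ 3) ^ j * a j)).
{ intros j M HM.
  assert (a0 : 0 <= a j) by apply Rabs_pos.
  apply Rle_trans with (2 * a j * ((/ 3) ^ S j - (/ 3) ^ M)).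
  - induction HM as [|M HM IHM].
    + rewrite !Rminus_diag, Rabs_R0; lra.
    + destruct (YS M) as [s [Es [-> _]]].
      rewrite (UL j) by (trivial; apply Bh).
      replace (1 * U j (y M) + s * U j (h M) - U j (y (S j)))
        with (U j (y M) - U j (y (S j)) + s * U j (h M)) by ring.
      eapply Rle_trans; [apply Rabs_triang|]; rewrite Rabs_mult, Es.
      replace (2 * a j * ((/ 3) ^ S j - (/ 3) ^ S M))
        with (2 * a j * ((/ 3) ^ S j - (/ 3) ^ M) + (/ 3) ^ M * (4 / 3 * a j))
        by (rewrite <- !tech_pow_Rmult; field).
      apply Rplus_le_compat; [exact IHM|].
      apply Rmult_le_compat_l; [apply pow_le; lra|apply Hah].
  - rewrite <- tech_pow_Rmult.
    assert (0 <= (/ 3) ^ M * a j) by (apply Rmult_le_pos; [apply pow_le; lra|exact a0]).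
    lra. }
assert (Lz : forall j, / 3 * ((/ 3) ^ j * a j) <= Rabs (U j z)).
{ intros j; destruct (proj2 (HT (fst (nk j))) _ Bz) as [C HC]; fold (U j) in HC.
  (* Boundedness of [U j] on the rescaled remainders replaces continuity: [U j (y M)] tends to
     [U j z] at the rate [(/ 3) ^ M]. *)
  assert (E : forall M, (S j <= M)%nat ->
    / 3 * ((/ 3) ^ j * a j) <= Rabs (U j z) + C * (/ 3) ^ M).
  { intros M HM; specialize (HC M); rewrite (UL j) in HC by trivial.
    replace (3 ^ M * U j z + - 3 ^ M * U j (y M)) with (3 ^ M * (U j z - U j (y M))) in HC
      by ring.
    assert (P : 0 < 3 ^ M) by (apply pow_lt; lra).
    rewrite Rabs_mult, (Rabs_pos_eq (3 ^ M)) in HC by lra.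
    apply (Rmult_le_compat_l (/ 3 ^ M)) in HC; [|left; now apply Rinv_0_lt_compat].
    rewrite <- Rmult_assoc, Rinv_l, Rmult_1_l, <- pow_inv, Rmult_comm in HC by lra.
    specialize (Tail j M HM); specialize (Low j).
    pose proof (Rabs_triang_inv (U j (y (S j))) (U j z)) as T1.
    pose proof (Rabs_triang (U j (y (S j)) - U j (y M)) (U j (y M) - U j z)) as T2.
    replace (U j (y (S j)) - U j (y M) + (U j (y M) - U j z))
      with (U j (y (S j)) - U j z) in T2 by ring.
    rewrite (Rabs_minus_sym (U j (y (S j))) (U j (y M))),
      (Rabs_minus_sym (U j (y M)) (U j z)) in T2.
    lra. }
  apply Rle_plus_epsilon; intros eps Heps.
  assert (C1 : 0 < Rabs C + 1) by (pose proof (Rabs_pos C); lra).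
  destruct (pow_lt_1_zero (/ 3) ltac:(rewrite Rabs_pos_eq; lra) (eps / (Rabs C + 1)))
    as [N HN]; [now apply Rdiv_lt_0_compat|].
  specialize (E (S j + N)%nat ltac:(lia)); specialize (HN (S j + N)%nat ltac:(lia)).
  assert (P : 0 < (/ 3) ^ (S j + N)) by (apply pow_lt; lra).
  rewrite Rabs_pos_eq in HN by lra.
  apply Rle_trans with (1 := E), Rplus_le_compat_l.
  apply Rle_trans with ((Rabs C + 1) * (/ 3) ^ (S j + N)).
  - apply Rmult_le_compat_r; [lra|]; pose proof (Rle_abs C); lra.
  - left; replace eps with ((Rabs C + 1) * (eps / (Rabs C + 1))) by (field; lra).
    now apply Rmult_lt_compat_l. }
destruct (Hpt z Fz) as [C HC].
destruct (Pow_x_infinity (4 / 3) ltac:(rewrite Rabs_pos_eq; lra) (3 * C + 1)) as [j Hj].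
specialize (Hj j (le_n j)); rewrite Rabs_pos_eq in Hj by (apply pow_le; lra).
specialize (HC (fst (nk j))); fold (U j) in HC.
assert (P : 0 < (/ 3) ^ j) by (apply pow_lt; lra).
assert (E : (4 / 3) ^ j <= (/ 3) ^ j * a j).
{ unfold Rdiv; rewrite Rpow_mult_distr, Rmult_comm; apply Rmult_le_compat_l; [lra|apply Ha]. }
specialize (Lz j); lra.
Qed.

(** * Tangent vectors acting on smooth families *)

(** A Banach-Steinhaus argument at each order: the next derivative is the pointwise limit of
    difference quotients with steps [(/ 2) ^ n], which are bounded functionals by induction. *)
Lemma derivative_functional_bounded (X : frolicher) (v : R -> (X -> R) -> R) p t :
  (forall t, bounded_functional X (v t)) ->
  (forall f, funct X f -> smooth (fun t => v t f)) ->
  bounded_functional X (fun f => Derive_n (fun s => v s f) p t).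
Proof.
intros Bv Sv; revert t; induction p as [|p IHp]; intros t; [apply Bv|].
assert (Lin : forall q s, linear_functional X (fun f => Derive_n (fun s => v s f) q s)).
{ intros q s f g a b Hf Hg.
  replace (fun s => v s (fun x => a * f x + b * g x))
    with (fun s => a * v s f + b * v s g)
    by (apply functional_extensionality; intros r; symmetry; now apply Bv).
  rewrite (Derive_n_lin (fun s => v s f) (fun s => v s g)); auto. }
split; [apply Lin|]; intros g Hg.
set (T := fun (n : nat) (f : X -> R) =>
  2 ^ n * Derive_n (fun s => v s f) p (t + (/ 2) ^ n) +
  - 2 ^ n * Derive_n (fun s => v s f) p t).
assert (HT : forall f, funct X f ->
  is_lim_seq (fun n => T n f) (Derive_n (fun s => v s f) (S p) t)).
{ intros f Hf; apply is_lim_seq_Reals.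
  assert (D : derivable_pt_lim (Derive_n (fun s => v s f) p) t
    (Derive_n (fun s => v s f) (S p) t)).
  { apply is_derive_Reals, Derive_correct, smooth_ex_derive, smooth_Derive_n; auto. }
  intros eps Heps; destruct (D eps Heps) as [d Hd].
  destruct (pow_lt_1_zero (/ 2) ltac:(rewrite Rabs_pos_eq; lra) d (cond_pos d)) as [N HN].
  exists N; intros n Hn; specialize (HN n Hn).
  assert (P : 0 < 2 ^ n) by (apply pow_lt; lra).
  specialize (Hd ((/ 2) ^ n) ltac:(apply pow_nonzero; lra) HN).
  replace (T n f) with ((Derive_n (fun s => v s f) p (t + (/ 2) ^ n) -
    Derive_n (fun s => v s f) p t) / (/ 2) ^ n); [exact Hd|].
  unfold T; rewrite pow_inv; field; lra. }
destruct (uniform_boundedness X T g) as [C HC]; trivial.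
- intros n; split.
  + intros f h a b Hf Hh; unfold T; rewrite !Lin by trivial; ring.
  + intros h Hh; destruct (proj2 (IHp (t + (/ 2) ^ n)) h Hh) as [C1 H1].
    destruct (proj2 (IHp t) h Hh) as [C2 H2].
    exists (2 ^ n * C1 + 2 ^ n * C2); intros k; unfold T.
    assert (P : 0 <= 2 ^ n) by (apply pow_le; lra).
    eapply Rle_trans; [apply Rabs_triang|].
    rewrite !Rabs_mult, Rabs_Ropp, (Rabs_pos_eq (2 ^ n)) by lra.
    apply Rplus_le_compat; apply Rmult_le_compat_l; auto.
- intros f Hf.
  destruct (maj_by_pos (fun n => T n f)) as [C [_ HC]]; [|now exists C].
  exists (Derive_n (fun s => v s f) (S p) t); now apply is_lim_seq_Reals, HT.
- exists C; intros k; apply lim_seq_Rabs_le with (1 := HT _ (proj1 Hg k)); auto.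
Qed.

(** From points [(t_n, s_n)] where the bound fails, the times give functionals and the parameters a
    bounded sequence of functions. Uniform boundedness controls all pairs of indices, in particular
    the diagonal ones, where it is contradicted. *)
Lemma functional_family_bounded (X : frolicher) (v : R -> (X -> R) -> R)
    (g : R -> X -> R) p :
  (forall t, bounded_functional X (v t)) ->
  (forall f, funct X f -> smooth (fun t => v t f)) ->
  (forall s, funct X (g s)) ->
  (forall c, curve X c -> forall q,
    loc_bounded (fun s r => Derive_n (fun r => g s (c r)) q r)) ->
  loc_bounded (fun t s => Derive_n (fun t => v t (g s)) p t).
Proof.
intros Bv Sv Fg Bg A; apply NNPP; intros N.
assert (Q : forall n : nat, exists z : R * R, Rabs (fst z) <= A /\ Rabs (snd z) <= A /\
  INR n < Rabs (Derive_n (fun t => v t (g (snd z))) p (fst z))).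
{ intros n; apply NNPP; intros N2; apply N; exists (INR n); intros t s Ht Hs.
  apply Rnot_lt_le; intros L; apply N2; now exists (t, s). }
destruct (choice _ Q) as [z Hz]; clear Q N.
destruct (uniform_boundedness X (fun n f => Derive_n (fun t => v t f) p (fst (z n)))
  (fun k => g (snd (z k)))) as [C HC].
- intros n; now apply derivative_functional_bounded.
- intros f Hf.
  destruct (smooth_bounded _ A (smooth_Derive_n _ p (Sv f Hf))) as [C HC].
  exists C; intros n; apply HC, Hz.
- split; [auto|]; intros c Hc q B.
  destruct (Bg c Hc q (Rmax A B)) as [C HC]; exists C; intros k t Ht; apply HC.
  + apply Rle_trans with (2 := Rmax_l _ _), Hz.
  + apply Rle_trans with (2 := Rmax_r _ _), Ht.
- destruct (INR_unbounded C) as [n Hn]; specialize (HC n n).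
  destruct (Hz n) as [_ [_ L]]; lra.
Qed.

Definition vderiv (X : frolicher) (v : tangent_total X) (f : X -> R) : R :=
  Derive (fun r => f (tangent_rep X v r)) 0.

Lemma vderiv_tangent (X : frolicher) c (Hc : curve X c) f : funct X f ->
  vderiv X (tangent X c Hc) f = Derive (fun t => f (c t)) 0.
Proof. intros Hf; exact (proj2 (tangent_rep_eq X c Hc) f Hf). Qed.

(** The two components of [T f] at [V t] are the value of [f] at the base point, written
    [tangent_rep X (V t) 0], and [vderiv X (V t) f]. *)
Lemma TF_curveE (X : frolicher) (V : R -> TF X) : curve (TF X) V <->
  curve X (fun t => tangent_rep X (V t) 0) /\
  forall f, funct X f -> smooth (fun t => vderiv X (V t) f).
Proof.
assert (E : forall (f : {f : X -> R | funct X f}) (v : tangent_total X),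
  tangent_real (tangent_map X realF (proj1_sig f)
    (funct_smooth_map X (proj1_sig f) (proj2_sig f)) v) =
  (proj1_sig f (tangent_rep X v 0), vderiv X v (proj1_sig f))).
{ intros f v; unfold tangent_map; now rewrite tangent_realE. }
split.
- intros H.
  assert (K : forall f, funct X f -> smooth (fun t => f (tangent_rep X (V t) 0)) /\
    smooth (fun t => vderiv X (V t) f)).
  { intros f Hf; specialize (H (exist _ f Hf)).
    apply prod_curve in H; destruct H as [H1 H2].
    replace (fun t => f (tangent_rep X (V t) 0)) with
      (fun t => fst (tangent_real (tangent_map X realF f (funct_smooth_map X f Hf) (V t))))
      by (apply functional_extensionality; intros t;
          exact (f_equal fst (E (exist _ f Hf) (V t)))).
    replace (fun t => vderiv X (V t) f) with
      (fun t => snd (tangent_real (tangent_map X realF f (funct_smooth_map X f Hf) (V t))))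
      by (apply functional_extensionality; intros t;
          exact (f_equal snd (E (exist _ f Hf) (V t)))).
    now split. }
  split; [apply curveP|]; intros f Hf; [exact (proj1 (K f Hf))|exact (proj2 (K f Hf))].
- intros [H1 H2] f; apply prod_curve; split.
  + replace (fun t => fst _) with (fun t => proj1_sig f (tangent_rep X (V t) 0))
      by (apply functional_extensionality; intros t; now rewrite E).
    apply (funct_curve X (proj1_sig f)); [exact (proj2_sig f)|exact H1].
  + replace (fun t => snd _) with (fun t => vderiv X (V t) (proj1_sig f))
      by (apply functional_extensionality; intros t; now rewrite E).
    apply H2; exact (proj2_sig f).
Qed.

Lemma vderiv_bounded (X : frolicher) v : bounded_functional X (vderiv X v).
Proof.
assert (Hc := tangent_rep_curve X v); split.
- intros f g a b Hf Hg; unfold vderiv.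
  rewrite (Derive_lin (fun r => f (tangent_rep X v r)) (fun r => g (tangent_rep X v r)));
    [reflexivity|now apply funct_curve..].
- intros g [_ Bg]; destruct (Bg _ Hc 1%nat 0) as [C HC].
  exists C; intros k; apply HC; rewrite Rabs_R0; lra.
Qed.

(** In uncurried form, a function of the product of [X] with [realF]. *)
Definition smooth_family (X : frolicher) (f : X -> R -> R) : Prop :=
  forall c a, curve X c -> smooth a -> smooth (fun t => f (c t) (a t)).

Lemma smooth_family_curve (X : frolicher) f c : smooth_family X f -> curve X c ->
  curve_smooth (fun r s => f (c r) s).
Proof.
intros Hf Hc a b Ha Hb; apply (Hf (fun t => c (a t)) b); [now apply curve_comp|exact Hb].
Qed.

Lemma smooth_family_Derive (X : frolicher) f : smooth_family X f ->
  smooth_family X (fun x => Derive (f x)).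
Proof.
intros Hf c a Hc Ha.
apply (curve_smooth_Derive_r _ (smooth_family_curve X f c Hf Hc) (fun t => t) a);
  [apply smooth_id|exact Ha].
Qed.

Lemma smooth_family_funct (X : frolicher) f s : smooth_family X f ->
  funct X (fun x => f x s).
Proof.
intros Hf; apply functP; intros c Hc; apply (Hf c (fun _ => s) Hc), smooth_const.
Qed.

Lemma vderiv_family_smooth (X : frolicher) v f : smooth_family X f ->
  smooth (fun s => vderiv X v (fun x => f x s)).
Proof.
intros Hf.
assert (HG := curve_smooth_bismooth _
  (smooth_family_curve X f _ Hf (tangent_rep_curve X v))).
exact (bismooth_r _ (bismooth_Derive_l _ HG) 0).
Qed.

(** Schwarz's theorem along a representing curve moves derivatives in the parameter inside the
    tangent vector, where they yield another smooth family. *)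
Lemma Derive_vderiv_family (X : frolicher) v f p : smooth_family X f ->
  Derive_n (fun s => vderiv X v (fun x => f x s)) p =
  (fun s => vderiv X v (fun x => Derive_n (f x) p s)).
Proof.
revert f; induction p as [|p IHp]; intros f Hf; [reflexivity|].
rewrite <- Derive_n_Derive.
replace (Derive (fun s => vderiv X v (fun x => f x s)))
  with (fun s => vderiv X v (fun x => Derive (f x) s)).
- rewrite (IHp (fun x => Derive (f x))) by now apply smooth_family_Derive.
  apply functional_extensionality; intros s; f_equal.
  apply functional_extensionality; intros x; now rewrite Derive_n_Derive.
- apply functional_extensionality; intros s.
  exact (bismooth_schwarz _ 0 s (curve_smooth_bismooth _
    (smooth_family_curve X f _ Hf (tangent_rep_curve X v)))).
Qed.

Lemma smooth_family_Derive_n (X : frolicher) f p : smooth_family X f ->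
  smooth_family X (fun x => Derive_n (f x) p).
Proof.
revert f; induction p as [|p IHp]; intros f Hf; [exact Hf|].
replace (fun x => Derive_n (f x) (S p)) with (fun x => Derive_n (Derive (f x)) p).
- now apply (IHp (fun x => Derive (f x))), smooth_family_Derive.
- apply functional_extensionality; intros x; apply Derive_n_Derive.
Qed.

Lemma vderiv_family_bismooth (X : frolicher) (V : R -> TF X) f :
  curve (TF X) V -> smooth_family X f ->
  bismooth (fun t s => vderiv X (V t) (fun x => f x s)).
Proof.
intros HV; apply TF_curveE in HV; destruct HV as [_ HV].
assert (B : forall f, smooth_family X f -> forall p, loc_bounded (fun t s =>
  Derive_n (fun t => vderiv X (V t) (fun x => f x s)) p t)).
{ intros h Hh p.
  apply (functional_family_bounded X (fun t => vderiv X (V t)) (fun s x => h x s)).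
  - intros t; apply vderiv_bounded.
  - exact HV.
  - intros s; now apply smooth_family_funct.
  - intros c Hc q.
    exact (loc_bounded_swap _ (bismooth_bound_l _ (curve_smooth_bismooth _
      (smooth_family_curve X h c Hh Hc)) q)). }
intros Hf; split.
- intros s; now apply HV, smooth_family_funct.
- intros t; now apply vderiv_family_smooth.
- now apply B.
(* Derivatives in [s] fall on the family, so [B] at order 0 for the derived family bounds them. *)
- intros p A.
  destruct (B (fun x => Derive_n (f x) p) (smooth_family_Derive_n X f p Hf) 0%nat A)
    as [C HC].
  exists C; intros t s Ht Hs.
  rewrite (Derive_vderiv_family X (V t) f p Hf); now apply HC.
Qed.

Lemma vderiv_diagonal_smooth (X : frolicher) (V : R -> TF X) f :
  curve (TF X) V -> smooth_family X f ->
  smooth (fun t => vderiv X (V t) (fun x => f x t)).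
Proof.
intros HV Hf.
exact (bismooth_curve_smooth _ (vderiv_family_bismooth X V f HV Hf)
  (fun t => t) (fun t => t) smooth_id smooth_id).
Qed.

(** * Products and the isomorphism *)

Lemma prod_pair_curve (X Y : frolicher) c d : curve X c -> curve Y d ->
  curve (prodF X Y) (fun t => (c t, d t)).
Proof. intros Hc Hd; apply prod_curve; now split. Qed.

Lemma prod_funct_Derive (X Y : frolicher) f c d : funct (prodF X Y) f ->
  curve X c -> curve Y d ->
  Derive (fun t => f (c t, d t)) 0 =
  Derive (fun t => f (c t, d 0)) 0 + Derive (fun t => f (c 0, d t)) 0.
Proof.
intros Hf Hc Hd.
assert (HG : bismooth (fun r s => f (c r, d s))).
{ apply curve_smooth_bismooth; intros a b Ha Hb.
  apply (funct_curve (prodF X Y) f (fun t => (c (a t), d (b t))) Hf).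
  apply prod_pair_curve; now apply curve_comp. }
apply is_derive_unique.
assert (D := bismooth_chain _ (fun t => t) (fun t => t) 0 HG smooth_id smooth_id).
simpl in D; rewrite Derive_id, !Rmult_1_r in D; exact D.
Qed.

Lemma prod_funct_slice_l (X Y : frolicher) f y : funct (prodF X Y) f ->
  funct X (fun x => f (x, y)).
Proof.
intros Hf; apply functP; intros c Hc.
apply (funct_curve (prodF X Y) f (fun t => (c t, y)) Hf).
apply prod_pair_curve; [exact Hc|apply curve_const].
Qed.

Lemma prod_funct_slice_r (X Y : frolicher) f x : funct (prodF X Y) f ->
  funct Y (fun y => f (x, y)).
Proof.
intros Hf; apply functP; intros c Hc.
apply (funct_curve (prodF X Y) f (fun t => (x, c t)) Hf).
apply prod_pair_curve; [apply curve_const|exact Hc].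
Qed.

Lemma smooth_map_fst (X Y : frolicher) : smooth_map (prodF X Y) X fst.
Proof. intros c Hc; now apply prod_curve. Qed.

Lemma smooth_map_snd (X Y : frolicher) : smooth_map (prodF X Y) Y snd.
Proof. intros c Hc; now apply prod_curve. Qed.

Lemma tangent_map_smooth (X Y : frolicher) phi (Hphi : smooth_map X Y phi) :
  smooth_map (TF X) (TF Y) (tangent_map X Y phi Hphi).
Proof.
intros V HV; apply TF_curveE in HV; destruct HV as [HV0 HV1]; apply TF_curveE; split.
- replace (fun t => tangent_rep Y (tangent_map X Y phi Hphi (V t)) 0)
    with (fun t => phi (tangent_rep X (V t) 0)); [now apply Hphi|].
  apply functional_extensionality; intros t; symmetry; apply tangent_rep_eq.
- intros f Hf.
  replace (fun t => vderiv Y (tangent_map X Y phi Hphi (V t)) f)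
    with (fun t => vderiv X (V t) (fun x => f (phi x))).
  + now apply HV1, (smooth_map_funct X Y).
  + apply functional_extensionality; intros t; symmetry; now apply vderiv_tangent.
Qed.

(** Built from chosen representatives; [prod_funct_Derive] shows, inside [lemma6], that the choice
    does not affect the class. *)
Definition tangent_pair (X Y : frolicher) (vw : tangent_total X * tangent_total Y) :
    tangent_total (prodF X Y) :=
  tangent (prodF X Y) (fun t => (tangent_rep X (fst vw) t, tangent_rep Y (snd vw) t))
    (prod_pair_curve X Y _ _ (tangent_rep_curve X (fst vw)) (tangent_rep_curve Y (snd vw))).

Lemma tangent_pair_smooth (X Y : frolicher) :
  smooth_map (prodF (TF X) (TF Y)) (TF (prodF X Y)) (tangent_pair X Y).
Proof.
intros V HV; apply prod_curve in HV; destruct HV as [HV HW].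
assert (HV' := HV); assert (HW' := HW).
apply TF_curveE in HV', HW'; destruct HV' as [Hx _], HW' as [Hy _].
set (x := fun t => tangent_rep X (fst (V t)) 0) in *.
set (y := fun t => tangent_rep Y (snd (V t)) 0) in *.
apply TF_curveE; split.
- replace (fun t => tangent_rep (prodF X Y) (tangent_pair X Y (V t)) 0)
    with (fun t => (x t, y t)); [now apply prod_pair_curve|].
  apply functional_extensionality; intros t; symmetry.
  exact (proj1 (tangent_rep_eq (prodF X Y) _ _)).
- intros f Hf.
  replace (fun t => vderiv (prodF X Y) (tangent_pair X Y (V t)) f)
    with (fun t => vderiv X (fst (V t)) (fun x => f (x, y t)) +
                   vderiv Y (snd (V t)) (fun y => f (x t, y))).
  (* Each summand is a diagonal: the tangent vector moves with [t], and so does the function it acts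
     on, through the base point in the other factor. *)
  + apply smooth_plus.
    * apply (vderiv_diagonal_smooth X (fun t => fst (V t)) (fun x t => f (x, y t)) HV).
      intros c a Hc Ha; apply (funct_curve (prodF X Y) f (fun t => (c t, y (a t))) Hf).
      apply prod_pair_curve; [exact Hc|now apply curve_comp].
    * apply (vderiv_diagonal_smooth Y (fun t => snd (V t)) (fun y t => f (x t, y)) HW).
      intros c a Hc Ha; apply (funct_curve (prodF X Y) f (fun t => (x (a t), c t)) Hf).
      apply prod_pair_curve; [now apply curve_comp|exact Hc].
  + apply functional_extensionality; intros t; symmetry.
    unfold tangent_pair; rewrite vderiv_tangent by exact Hf.
    apply (prod_funct_Derive X Y f _ _ Hf); apply tangent_rep_curve.
Qed.

Theorem lemma6 : forall X Y : frolicher,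
  isomorphic (TF (prodF X Y)) (prodF (TF X) (TF Y)).
Proof.
intros X Y.
exists (fun z => (tangent_map (prodF X Y) X fst (smooth_map_fst X Y) z,
                  tangent_map (prodF X Y) Y snd (smooth_map_snd X Y) z)).
split.
{ intros V HV; apply (prod_pair_curve (TF X) (TF Y)); now apply tangent_map_smooth. }
exists (tangent_pair X Y); split; [apply tangent_pair_smooth|split].
(* The third occurrence of [z] is the right-hand side, so both sides become classes of explicit
   curves and [tangentP] applies. *)
- intros z; rewrite <- (tangent_repK (prodF X Y) z) at 3.
  set (c := tangent_rep (prodF X Y) z).
  set (Hc := tangent_rep_curve (prodF X Y) z : curve (prodF X Y) c).
  assert (Hc' := Hc); apply prod_curve in Hc'; destruct Hc' as [H1 H2].
  destruct (tangent_rep_eq X (fun t => fst (c t)) (smooth_map_fst X Y c Hc)) as [E1 D1].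
  destruct (tangent_rep_eq Y (fun t => snd (c t)) (smooth_map_snd X Y c Hc)) as [E2 D2].
  apply tangentP; simpl; split.
  + unfold tangent_map; fold c.
    rewrite (surjective_pairing (c 0)); f_equal; [apply E1|apply E2].
  + intros f Hf.
    rewrite (prod_funct_Derive X Y f _ _ Hf (tangent_rep_curve X _) (tangent_rep_curve Y _)).
    replace (fun t => f (c t)) with (fun t => f (fst (c t), snd (c t)))
      by (apply functional_extensionality; intros t; now rewrite <- surjective_pairing).
    rewrite (prod_funct_Derive X Y f _ _ Hf H1 H2).
    f_equal.
    (* The slices are taken at the base point of the chosen representative in the other factor,
       which [E2] identifies with that of [c]; the second summand uses [E1] in the same way. *)
    * etransitivity; [apply (D1 _ (prod_funct_slice_l X Y f _ Hf))|].
      f_equal; apply functional_extensionality; intros t; do 2 f_equal; apply E2.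
    * etransitivity; [apply (D2 _ (prod_funct_slice_r X Y f _ Hf))|].
      f_equal; apply functional_extensionality; intros t; do 2 f_equal; apply E1.
- intros [v w]; apply f_equal2.
  + etransitivity; [apply tangent_mapE|].
    etransitivity; [|apply tangent_repK]; apply tangentP; now split.
  + etransitivity; [apply tangent_mapE|].
    etransitivity; [|apply tangent_repK]; apply tangentP; now split.
Qed.
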